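(* Let $n\ge1$, $u\in\mathbb C$ with $u\ne0$, and let $\ddot{\mathfrak H}^-$ be the rational spin double affine Hecke algebra with parameter $u$. Let $W$ be a $\mathbb C S_n^-$-module, extended to a module over the subalgebra $\mathfrak H^-_\xi$ with each $\xi_i$ acting by $0$, and identify the induced module $\mathrm{Ind}_{\mathfrak H^-_\xi}^{\ddot{\mathfrak H}^-}W$ with $\mathbb C[y_1,\dots,y_n]\otimes W$ as a vector space. Denote the action by $\circ$. Then for any polynomial $f=f(y_1,\dots,y_n)$, any $w\in W$ and $1\le i\le n$, $$\xi_i\circ(f\otimes w)=u\sum_{k\neq i}\frac{(1-s_{ki})(f)}{y_i-y_k}\otimes[k,i](w).$$
   Context: The spin symmetric group algebra $\mathbb C S_n^-$ is the $\mathbb C$-algebra generated by $t_1,\dots,t_{n-1}$ subject to $t_i^2=1$, $t_it_{i+1}t_i=t_{i+1}t_it_{i+1}$, and $t_it_j=-t_jt_i$ for $|i-j|>1$. For $1\le i<j\le n$ set $[i,j]=-[j,i]=(-1)^{j-i-1}t_{j-1}\cdots t_{i+1}t_it_{i+1}\cdots t_{j-1}$. The rational spin double affine Hecke algebra $\ddot{\mathfrak H}^-$ with parameter $u\in\mathbb C$ is the $\mathbb C$-algebra generated by $\xi_i,y_i$ ($1\le i\le n$) and $t_i$ ($1\le i\le n-1$), subject to the relations $t_i^2=1$, $t_it_{i+1}t_i=t_{i+1}t_it_{i+1}$, $t_it_j=-t_jt_i$ for $|i-j|>1$, and: $\xi_i\xi_j=-\xi_j\xi_i$, $y_iy_j=y_jy_i$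 for $i\neq j$; $t_i\xi_i=-\xi_{i+1}t_i$, $t_iy_i=y_{i+1}t_i$; $t_j\xi_i=-\xi_it_j$, $t_jy_i=y_it_j$ for $i\neq j,j+1$; the commutator relations $y_i\xi_j-\xi_jy_i=u[i,j]$ for $i\ne j$, and $y_i\xi_i-\xi_iy_i=u\sum_{k\neq i}[i,k]$. $\mathfrak H^-_\xi$ is the subalgebra of $\ddot{\mathfrak H}^-$ generated by $\mathbb C S_n^-$ and $\xi_1,\dots,\xi_n$. The identification of the induced module $\ddot{\mathfrak H}^-\otimes_{\mathfrak H^-_\xi}W$ with $\mathbb C[y_1,\dots,y_n]\otimes W$ sends $f\otimes w$ ($f\in\mathbb C[y_1,\dots,y_n]$, $w\in W$) to $f\otimes w$ (a vector space isomorphism by the PBW property). The transposition $s_{ki}\in S_n$ acts on polynomials in $y_1,\dots,y_n$ by exchanging $y_k$ and $y_i$; the quotient $\frac{(1-s_{ki})(f)}{y_i-y_k}$ is a polynomial. *)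

(* Defs.v *)
From HB Require Import structures.
From mathcomp Require Import all_boot all_order all_algebra all_fingroup.
From mathcomp Require Import generic_quotient ring_quotient.
From mathcomp Require Import boolp classical_sets reals.
From mathcomp Require Import finmap complex ssrcomplements mpoly.
From mathcomp Require monalg.

Set Implicit Arguments.
Unset Strict Implicit.
Unset Printing Implicit Defensive.

Import GRing.Theory.
Local Open Scope ring_scope.
Local Open Scope quotient_scope.

(* [monalg] declares notations (such as [{mpoly R[n]}]) which clash with those
   of [mpoly], hence it is only imported locally. *)
Module Free.
Import monalg.

Definition free_alg (K : comNzRingType) (X : choiceType) : Type :=
  {malg K[{fmonom X}]}.

HB.instance Definition _ (K : comNzRingType) (X : choiceType) :=
  GRing.Lalgebra.on (free_alg K X).

Definition free_gen (K : comNzRingType) (X : choiceType) (x : X) :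
  free_alg K X := mkmalgU (fmu x) 1.

Lemma free_alg_central (K : comNzRingType) (X : choiceType) (c : K)
  (x : free_alg K X) : x * c%:A = c *: x.
Proof.
have -> : c%:A = mkmalgU (@mone (fmonom X)) c :> free_alg K X.
  by rewrite -(@mul_malgC (fmonom X) K c 1) mulr1.
rewrite [LHS](@malgM_def (fmonom X) K) [RHS](@malgZ_def (fmonom X) K) fgmulgU.
by apply: eq_bigr => k _; rewrite mulm1 mulrC.
Qed.

Definition free_ab (T : choiceType) : Type := {malg int[T]}.

HB.instance Definition _ (T : choiceType) := GRing.Zmodule.on (free_ab T).

Definition ab_gen (T : choiceType) (x : T) : free_ab T := mkmalgU x 1.

Section Lift.
Variables (T : choiceType) (M : zmodType) (g : T -> M).

Definition ab_lift (x : free_ab T) : M :=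
  \sum_(k <- enum_fset (msupp x)) g k *~ mcoeff k x.

Lemma ab_liftEw (x : free_ab T) (D : {fset T}) : (msupp x `<=` D)%fset ->
  ab_lift x = \sum_(k <- enum_fset D) g k *~ mcoeff k x.
Proof.
move=> sxD; apply: big_fset_incl => // k _ /mcoeff_outdom ->.
by rewrite mulr0z.
Qed.

Lemma ab_lift_is_zmod_morphism : zmod_morphism ab_lift.
Proof.
move=> x y; pose D := (msupp x `|` msupp y)%fset.
rewrite (@ab_liftEw (x - y) D) ?(@ab_liftEw x D) ?(@ab_liftEw y D) ?fsubsetUl
  ?fsubsetUr ?msuppB_le // -sumrB.
by apply: eq_bigr => k _; rewrite mcoeffB mulrzBr.
Qed.

HB.instance Definition _ :=
  GRing.isZmodMorphism.Build (free_ab T) M ab_lift ab_lift_is_zmod_morphism.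

Lemma ab_lift_gen (x : T) : ab_lift (ab_gen x) = g x.
Proof.
rewrite (@ab_liftEw _ [fset x]%fset) ?msuppU_le //.
by rewrite big_seq_fset1 mcoeffUU.
Qed.

End Lift.

Lemma eq_ab_lift (T : choiceType) (M : zmodType)
    (f g : {additive free_ab T -> M}) :
  (forall k, f (ab_gen k) = g (ab_gen k)) -> f =1 g.
Proof.
move=> fg x; rewrite [x]monalgE !raddf_sum; apply: eq_bigr => k _.
have -> : << mcoeff k x *g k >> = ab_gen k *~ mcoeff k x :> free_ab T.
  by rewrite /ab_gen -(raddfMz (mkmalgU k)) intz.
by rewrite !raddfMz fg.
Qed.

End Free.
Export Free.

(* The smallest two-sided ideal containing the differences [x - y] of the
   related pairs, and the quotient by it.  Since [0] and [1] are not known to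
   differ in the quotient, the latter is only a [pzRingType]. *)
Section IdealQuotient.
Variables (A : pzRingType) (rel : A -> A -> Prop).

Inductive ideal_gen : A -> Prop :=
| ideal_gen_rel x y : rel x y -> ideal_gen (x - y)
| ideal_gen0 : ideal_gen 0
| ideal_genB x y : ideal_gen x -> ideal_gen y -> ideal_gen (x - y)
| ideal_genMl a x : ideal_gen x -> ideal_gen (a * x)
| ideal_genMr a x : ideal_gen x -> ideal_gen (x * a).

Definition in_ideal : {pred A} := fun x => `[< ideal_gen x >].

Lemma in_ideal_zmod_closed : zmod_closed in_ideal.
Proof.
split; first exact/asboolP/ideal_gen0.
by move=> x y /asboolP hx /asboolP hy; apply/asboolP/ideal_genB.
Qed.

HB.instance Definition _ :=
  GRing.isZmodClosed.Build A in_ideal in_ideal_zmod_closed.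

Definition rquot : Type := Quotient.quot (in_ideal : zmodClosed A).

HB.instance Definition _ := EqQuotient.on rquot.
HB.instance Definition _ := GRing.Zmodule.on rquot.

Definition rquot_pi (x : A) : rquot := \pi_(rquot) x.

Lemma rquot_eqP (x y : A) : rquot_pi x = rquot_pi y <-> ideal_gen (x - y).
Proof.
split.
- move=> /eqmodP h; have: in_ideal (x - y) by exact: h.
  by move/asboolP.
- by move=> h; apply/eqmodP; apply/asboolP.
Qed.

Lemma rquot_pi_is_zmod_morphism : zmod_morphism rquot_pi.
Proof. by move=> x y; rewrite /rquot_pi !piE. Qed.

HB.instance Definition _ :=
  GRing.isZmodMorphism.Build A rquot rquot_pi rquot_pi_is_zmod_morphism.

Lemma rquot_piK (x : rquot) : rquot_pi (repr x) = x.
Proof. exact: reprK. Qed.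

Definition rquot_one : rquot := rquot_pi 1.
Definition rquot_mul (x y : rquot) : rquot := rquot_pi (repr x * repr y).

Lemma rquot_mulE (x y : A) :
  rquot_mul (rquot_pi x) (rquot_pi y) = rquot_pi (x * y).
Proof.
apply/rquot_eqP; set x' := repr _; set y' := repr _.
have hx : ideal_gen (x' - x) by apply/rquot_eqP; rewrite rquot_piK.
have hy : ideal_gen (y - y') by apply/rquot_eqP; rewrite rquot_piK.
have -> : x' * y' - x * y = (x' - x) * y' - x * (y - y').
  by rewrite mulrBl mulrBr opprB addrA subrK.
by apply: ideal_genB; [apply: ideal_genMr | apply: ideal_genMl].
Qed.

Lemma rquot_mulA : associative rquot_mul.
Proof.
move=> x y z; rewrite -(rquot_piK x) -(rquot_piK y) -(rquot_piK z).
by rewrite !rquot_mulE mulrA.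
Qed.
Lemma rquot_mul1 : left_id rquot_one rquot_mul.
Proof. by move=> x; rewrite -(rquot_piK x) rquot_mulE mul1r. Qed.
Lemma rquot_mulr1 : right_id rquot_one rquot_mul.
Proof. by move=> x; rewrite -(rquot_piK x) rquot_mulE mulr1. Qed.
Lemma rquot_mulDl : left_distributive rquot_mul +%R.
Proof.
move=> x y z; rewrite -(rquot_piK x) -(rquot_piK y) -(rquot_piK z).
by rewrite -raddfD !rquot_mulE mulrDl raddfD.
Qed.
Lemma rquot_mulDr : right_distributive rquot_mul +%R.
Proof.
move=> x y z; rewrite -(rquot_piK x) -(rquot_piK y) -(rquot_piK z).
by rewrite -raddfD !rquot_mulE mulrDr raddfD.
Qed.

HB.instance Definition _ := GRing.Zmodule_isPzRing.Build rquot
  rquot_mulA rquot_mul1 rquot_mulr1 rquot_mulDl rquot_mulDr.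

Lemma rquot_pi_is_monoid_morphism : monoid_morphism rquot_pi.
Proof. by split=> // x y; rewrite -rquot_mulE. Qed.

HB.instance Definition _ :=
  GRing.isMonoidMorphism.Build A rquot rquot_pi rquot_pi_is_monoid_morphism.

End IdealQuotient.

(* The associative unital [K]-algebra generated by [X] subject to [rel]. *)
Section PresentedAlgebra.
Variables (K : comNzRingType) (X : choiceType).
Variable rel : free_alg K X -> free_alg K X -> Prop.

Definition presented_alg : Type := rquot rel.

HB.instance Definition _ := GRing.PzRing.on presented_alg.

Definition palg_pi : {rmorphism free_alg K X -> presented_alg} :=
  @rquot_pi _ rel.

Definition palg_gen (x : X) : presented_alg := palg_pi (free_gen K x).

Definition palg_scalar (c : K) : presented_alg :=
  palg_pi (c%:A : free_alg K X).

Lemma palg_scalar_is_zmod_morphism : zmod_morphism palg_scalar.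
Proof. by move=> a b; rewrite /palg_scalar scalerBl rmorphB. Qed.
Lemma palg_scalar_is_monoid_morphism : monoid_morphism palg_scalar.
Proof.
split=> [|a b]; rewrite /palg_scalar ?scale1r ?rmorph1 // -rmorphM.
by rewrite -scalerAl mul1r scalerA.
Qed.

HB.instance Definition _ := GRing.isZmodMorphism.Build K presented_alg
  palg_scalar palg_scalar_is_zmod_morphism.
HB.instance Definition _ := GRing.isMonoidMorphism.Build K presented_alg
  palg_scalar palg_scalar_is_monoid_morphism.

Definition palg_scale (c : K) (x : presented_alg) : presented_alg :=
  palg_scalar c * x.

Lemma palg_scaleA a b x : palg_scale a (palg_scale b x) = palg_scale (a * b) x.
Proof.
rewrite /palg_scale [LHS]mulrA; congr (_ * x).
exact/esym/(rmorphM palg_scalar).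
Qed.
Lemma palg_scale1 : left_id 1 palg_scale.
Proof. by move=> x; rewrite /palg_scale rmorph1 mul1r. Qed.
Lemma palg_scaleDr : right_distributive palg_scale +%R.
Proof. by move=> c x y; rewrite /palg_scale mulrDr. Qed.
Lemma palg_scaleDl x : {morph palg_scale^~ x : a b / a + b}.
Proof. by move=> a b; rewrite /palg_scale rmorphD mulrDl. Qed.

HB.instance Definition _ := GRing.Zmodule_isLmodule.Build K presented_alg
  palg_scaleA palg_scale1 palg_scaleDr palg_scaleDl.

Lemma palg_scalarE (c : K) (x : presented_alg) : c *: x = palg_scalar c * x.
Proof. by []. Qed.

Lemma palg_scalar_central (c : K) (x : presented_alg) :
  x * palg_scalar c = c *: x.
Proof.
rewrite palg_scalarE -(rquot_piK x) /palg_scalar -[rquot_pi _ _]/(palg_pi _).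
by rewrite -!rmorphM free_alg_central -scalerAl mul1r.
Qed.

(* The subalgebra generated by a set [S]. *)
Variable S : presented_alg -> Prop.

Inductive subalg_gen : presented_alg -> Prop :=
| subalg_gen_in x : S x -> subalg_gen x
| subalg_gen_scalar c : subalg_gen (palg_scalar c)
| subalg_genB x y : subalg_gen x -> subalg_gen y -> subalg_gen (x - y)
| subalg_genM x y : subalg_gen x -> subalg_gen y -> subalg_gen (x * y).

Definition in_subalg : {pred presented_alg} := fun x => `[< subalg_gen x >].

Lemma in_subalg_subring_closed : subring_closed in_subalg.
Proof.
split; first by apply/asboolP; rewrite -(rmorph1 palg_scalar);
  exact: subalg_gen_scalar.
- by move=> x y /asboolP hx /asboolP hy; apply/asboolP/subalg_genB.
- by move=> x y /asboolP hx /asboolP hy; apply/asboolP/subalg_genM.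
Qed.

HB.instance Definition _ :=
  GRing.isSubringClosed.Build presented_alg in_subalg in_subalg_subring_closed.

Record subalg : Type :=
  Subalg { subalg_val : presented_alg; _ : in_subalg subalg_val }.

HB.instance Definition _ := [isSub for subalg_val].
HB.instance Definition _ := [Choice of subalg by <:].
HB.instance Definition _ := GRing.SubChoice_isSubPzRing.Build
  presented_alg in_subalg subalg in_subalg_subring_closed.

Definition subalg_incl : {rmorphism subalg -> presented_alg} := (\val : subalg -> presented_alg).

Definition subalg_elt (x : presented_alg) (Sx : subalg_gen x) : subalg :=
  Subalg (introT (asboolP _) Sx).

End PresentedAlgebra.

(* Restriction of scalars along [phi]. *)
Section Restriction.
Variables (A B : pzRingType).

Definition restrict (phi : {rmorphism A -> B}) (V : lmodType B) : Type := V.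

Variables (phi : {rmorphism A -> B}) (V : lmodType B).
Local Notation restr := (restrict phi V).

HB.instance Definition _ := GRing.Zmodule.copy restr V.

Definition restr_scale (a : A) (v : restr) : restr := phi a *: (v : V).

Lemma restr_scaleA a b v : restr_scale a (restr_scale b v) = restr_scale (a * b) v.
Proof. by rewrite /restr_scale scalerA -rmorphM. Qed.
Lemma restr_scale1 : left_id 1 restr_scale.
Proof. by move=> v; rewrite /restr_scale rmorph1 scale1r. Qed.
Lemma restr_scaleDr : right_distributive restr_scale +%R.
Proof. by move=> a v w; rewrite /restr_scale scalerDr. Qed.
Lemma restr_scaleDl v : {morph restr_scale^~ v : a b / a + b}.
Proof. by move=> a b; rewrite /restr_scale rmorphD scalerDl. Qed.

HB.instance Definition _ := GRing.Zmodule_isLmodule.Build A restr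
  restr_scaleA restr_scale1 restr_scaleDr restr_scaleDl.

End Restriction.

(* The tensor product [A (x)_B W] of [A], seen as a right [B]-module along
   [phi], with a left [B]-module [W]; it is a left [A]-module. *)
Section Extension.
Variables (A B : pzRingType) (phi : {rmorphism B -> A}) (W : lmodType B).

Local Notation pre := (free_ab (A * W)%type).
Local Notation "<[ a , w ]>" := (ab_gen (a, w) : pre).

Inductive tensor_rel : pre -> Prop :=
| tensor_relDl a b w : tensor_rel (<[a + b, w]> - <[a, w]> - <[b, w]>)
| tensor_relDr a v w : tensor_rel (<[a, v + w]> - <[a, v]> - <[a, w]>)
| tensor_relM a b w : tensor_rel (<[a * phi b, w]> - <[a, b *: w]>)
| tensor_rel0 : tensor_rel 0
| tensor_relB x y : tensor_rel x -> tensor_rel y -> tensor_rel (x - y).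

Definition in_tensor_rel : {pred pre} := fun x => `[< tensor_rel x >].

Lemma in_tensor_rel_zmod_closed : zmod_closed in_tensor_rel.
Proof.
split; first exact/asboolP/tensor_rel0.
by move=> x y /asboolP hx /asboolP hy; apply/asboolP/tensor_relB.
Qed.

HB.instance Definition _ :=
  GRing.isZmodClosed.Build pre in_tensor_rel in_tensor_rel_zmod_closed.

Definition tensor : Type := Quotient.quot (in_tensor_rel : zmodClosed pre).

HB.instance Definition _ := EqQuotient.on tensor.
HB.instance Definition _ := GRing.Zmodule.on tensor.

Definition tensor_pi (x : pre) : tensor := \pi_(tensor) x.

Lemma tensor_eqP (x y : pre) : tensor_pi x = tensor_pi y <-> tensor_rel (x - y).
Proof.
split.
- move=> /eqmodP h; have: in_tensor_rel (x - y) by exact: h.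
  by move/asboolP.
- by move=> h; apply/eqmodP; apply/asboolP.
Qed.

Lemma tensor_pi_is_zmod_morphism : zmod_morphism tensor_pi.
Proof. by move=> x y; rewrite /tensor_pi !piE. Qed.

HB.instance Definition _ :=
  GRing.isZmodMorphism.Build pre tensor tensor_pi tensor_pi_is_zmod_morphism.

Lemma tensor_piK (x : tensor) : tensor_pi (repr x) = x.
Proof. exact: reprK. Qed.

(* The pure tensor [a (x) w]. *)
Definition tens (a : A) (w : W) : tensor := tensor_pi <[a, w]>.

Lemma tensDl a b w : tens (a + b) w = tens a w + tens b w.
Proof.
rewrite /tens -raddfD; apply/tensor_eqP; rewrite opprD addrA.
exact: tensor_relDl.
Qed.
Lemma tensDr a v w : tens a (v + w) = tens a v + tens a w.
Proof.
rewrite /tens -raddfD; apply/tensor_eqP; rewrite opprD addrA.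
exact: tensor_relDr.
Qed.
Lemma tensM a b w : tens (a * phi b) w = tens a (b *: w).
Proof. exact/tensor_eqP/tensor_relM. Qed.

(* The additive map sending [a (x) w] to [g a w], for a balanced map [g]. *)
Section Lift.
Variables (M : zmodType) (g : A -> W -> M).

Definition tensor_lift (x : tensor) : M :=
  ab_lift (fun k : A * W => g k.1 k.2) (repr x).

Hypothesis gDl : forall a b w, g (a + b) w = g a w + g b w.
Hypothesis gDr : forall a v w, g a (v + w) = g a v + g a w.
Hypothesis gM : forall a b w, g (a * phi b) w = g a (b *: w).

Lemma tensor_lift_pi (x : pre) :
  tensor_lift (tensor_pi x) = ab_lift (fun k : A * W => g k.1 k.2) x.
Proof.
pose G : {additive pre -> M} := ab_lift (fun k : A * W => g k.1 k.2).
rewrite /tensor_lift -/(G _) -/(G x).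
have G0 y : tensor_rel y -> G y = 0.
  elim=> [a b w|a v w|a b w||y1 y2 _ IH1 _ IH2];
    rewrite ?raddf0 // !raddfB /= /G /= ?ab_lift_gen /= ?IH1 ?IH2 ?subrr //.
  - by rewrite gDl -addrA -opprD subrr.
  - by rewrite gDr -addrA -opprD subrr.
  - by rewrite gM subrr.
apply/eqP; rewrite -subr_eq0 -raddfB; apply/eqP/G0/tensor_eqP.
exact: tensor_piK.
Qed.

Lemma tensor_lift_tens a w : tensor_lift (tens a w) = g a w.
Proof. by rewrite tensor_lift_pi ab_lift_gen. Qed.

Lemma tensor_lift_is_zmod_morphism : zmod_morphism tensor_lift.
Proof.
move=> x y; rewrite -(tensor_piK x) -(tensor_piK y) -raddfB.
by rewrite !tensor_lift_pi raddfB.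
Qed.

End Lift.

Definition tensor_scale (a : A) : tensor -> tensor :=
  tensor_lift (fun b w => tens (a * b) w).

Section Scale.
Variable a : A.
Let g b w := tens (a * b) w.
Let gDl b c w : g (b + c) w = g b w + g c w.
Proof. by rewrite /g mulrDr tensDl. Qed.
Let gDr b v w : g b (v + w) = g b v + g b w.
Proof. by rewrite /g tensDr. Qed.
Let gM b c w : g (b * phi c) w = g b (c *: w).
Proof. by rewrite /g mulrA tensM. Qed.

Lemma tensor_scale_tens b w : tensor_scale a (tens b w) = tens (a * b) w.
Proof. exact: (tensor_lift_tens gDl gDr gM). Qed.

Lemma tensor_scale_is_zmod_morphism : zmod_morphism (tensor_scale a).
Proof. exact: (tensor_lift_is_zmod_morphism gDl gDr gM). Qed.

HB.instance Definition _ := GRing.isZmodMorphism.Build tensor tensor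
  (tensor_scale a) tensor_scale_is_zmod_morphism.
End Scale.

Lemma eq_tensor_additive (M : zmodType) (f g : {additive tensor -> M}) :
  (forall a w, f (tens a w) = g (tens a w)) -> f =1 g.
Proof.
move=> fg x; rewrite -(tensor_piK x).
apply: (@eq_ab_lift _ _ (f \o tensor_pi) (g \o tensor_pi)) => -[a w].
exact: fg.
Qed.

Lemma tensor_scaleA a b x :
  tensor_scale a (tensor_scale b x) = tensor_scale (a * b) x.
Proof.
apply: (eq_tensor_additive (f := tensor_scale a \o tensor_scale b)) => c w.
by rewrite /= !tensor_scale_tens mulrA.
Qed.
Lemma tensor_scale1 : left_id 1 tensor_scale.
Proof.
apply: (eq_tensor_additive (g := idfun)) => c w.
by rewrite /= tensor_scale_tens mul1r.
Qed.
Lemma tensor_scaleDr : right_distributive tensor_scale +%R.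
Proof. by move=> a x y; rewrite raddfD. Qed.
Lemma tensor_scaleDl x : {morph tensor_scale^~ x : a b / a + b}.
Proof.
move=> a b.
apply: (eq_tensor_additive (g := tensor_scale a \+ tensor_scale b)) => c w.
by rewrite /= !tensor_scale_tens mulrDl tensDl.
Qed.

HB.instance Definition _ := GRing.Zmodule_isLmodule.Build A tensor
  tensor_scaleA tensor_scale1 tensor_scaleDr tensor_scaleDl.

End Extension.

Arguments tens {A B phi W} a w.
Arguments tensDl {A B phi W} a b w.
Arguments tensDr {A B phi W} a v w.
Arguments tensM {A B phi W} a b w.

(* Indices are shifted by one with respect to [1, ..., n]: [xi_i] and [y_i] are
   indexed by [i < n], and [t_a] (with [a < n.-1]) corresponds to the simple
   transposition exchanging the indices [a] and [a.+1]. *)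
Section Relations.
Variable n : nat.

(* [(-1)^(j-i-1) t_(j-1) ... t_(i+1) t_i t_(i+1) ... t_(j-1)] for [i < j]. *)
Definition bracket_lt (A : pzRingType) (t : 'I_n.-1 -> A) (i j : 'I_n) : A :=
  (-1) ^+ (j - i - 1) *
  ((\prod_(a <- rev (enum 'I_n.-1) | (i <= a < j)%N) t a) *
   (\prod_(a <- enum 'I_n.-1 | (i < a < j)%N) t a)).

(* [i, j]; the junk value at [i = j] is not used. *)
Definition bracket (A : pzRingType) (t : 'I_n.-1 -> A) (i j : 'I_n) : A :=
  if (i < j)%N then bracket_lt t i j else - bracket_lt t j i.

Inductive spin_rel (A : pzRingType) (t : 'I_n.-1 -> A) : A -> A -> Prop :=
| spin_sqr a : spin_rel t (t a * t a) 1
| spin_braid (a b : 'I_n.-1) : b = a.+1 :> nat ->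
    spin_rel t (t a * t b * t a) (t b * t a * t b)
| spin_far (a b : 'I_n.-1) : (a.+1 < b)%N || (b.+1 < a)%N ->
    spin_rel t (t a * t b) (- (t b * t a)).

Inductive daha_rel (K : comNzRingType) (A : lalgType K) (u : K)
    (xi y : 'I_n -> A) (t : 'I_n.-1 -> A) : A -> A -> Prop :=
| daha_spin l r : spin_rel t l r -> daha_rel u xi y t l r
| daha_xi i j : i != j -> daha_rel u xi y t (xi i * xi j) (- (xi j * xi i))
| daha_y i j : i != j -> daha_rel u xi y t (y i * y j) (y j * y i)
| daha_t_xi (a : 'I_n.-1) (i j : 'I_n) : i = a :> nat -> j = a.+1 :> nat ->
    daha_rel u xi y t (t a * xi i) (- (xi j * t a))
| daha_t_y (a : 'I_n.-1) (i j : 'I_n) : i = a :> nat -> j = a.+1 :> nat ->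
    daha_rel u xi y t (t a * y i) (y j * t a)
| daha_t_xi_far (a : 'I_n.-1) (i : 'I_n) : i != a :> nat -> i != a.+1 :> nat ->
    daha_rel u xi y t (t a * xi i) (- (xi i * t a))
| daha_t_y_far (a : 'I_n.-1) (i : 'I_n) : i != a :> nat -> i != a.+1 :> nat ->
    daha_rel u xi y t (t a * y i) (y i * t a)
| daha_y_xi i j : i != j ->
    daha_rel u xi y t (y i * xi j - xi j * y i) (u *: bracket t i j)
| daha_y_xi_diag i :
    daha_rel u xi y t (y i * xi i - xi i * y i)
                      (u *: \sum_(k | k != i) bracket t i k).

End Relations.

Section SpinDAHA.
Variables (K : comNzRingType) (n : nat).

(* The spin symmetric group algebra. *)
Definition spin_alg : Type :=
  presented_alg (spin_rel (fun a : 'I_n.-1 => free_gen K a)).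

HB.instance Definition _ := GRing.PzRing.on spin_alg.
HB.instance Definition _ := GRing.Lmodule.on spin_alg.

Definition spin_t (a : 'I_n.-1) : spin_alg := palg_gen _ a.

Variable u : K.

Local Notation gens := ('I_n + 'I_n + 'I_n.-1)%type.

(* The rational spin double affine Hecke algebra. *)
Definition spin_daha : Type :=
  presented_alg (daha_rel u
    (fun i : 'I_n => free_gen K (inl (inl i) : gens))
    (fun i : 'I_n => free_gen K (inl (inr i) : gens))
    (fun a : 'I_n.-1 => free_gen K (inr a : gens))).

HB.instance Definition _ := GRing.PzRing.on spin_daha.
HB.instance Definition _ := GRing.Lmodule.on spin_daha.

Definition gen_xi (i : 'I_n) : spin_daha := palg_gen _ (inl (inl i)).
Definition gen_y (i : 'I_n) : spin_daha := palg_gen _ (inl (inr i)).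
Definition gen_t (a : 'I_n.-1) : spin_daha := palg_gen _ (inr a).

(* The subalgebra generated by the image of the spin symmetric group algebra,
   i.e. by the [t_a], and by the [xi_i]. *)
Inductive daha_xi_gens : spin_daha -> Prop :=
| daha_xi_gens_t a : daha_xi_gens (gen_t a)
| daha_xi_gens_xi i : daha_xi_gens (gen_xi i).

Definition daha_sub : Type := subalg daha_xi_gens.

HB.instance Definition _ := GRing.PzRing.on daha_sub.

Definition sub_scalar (c : K) : daha_sub :=
  subalg_elt (subalg_gen_scalar daha_xi_gens c).
Definition sub_t (a : 'I_n.-1) : daha_sub :=
  subalg_elt (subalg_gen_in (daha_xi_gens_t a)).
Definition sub_xi (i : 'I_n) : daha_sub :=
  subalg_elt (subalg_gen_in (daha_xi_gens_xi i)).

(* The extension of a module over the spin symmetric group algebra to a module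
   over [daha_sub] with each [xi_i] acting by [0]. *)
Record xi0_extension (V : lmodType spin_alg) := Xi0Extension {
  xact : daha_sub -> V -> V;
  xactA : forall a b v, xact a (xact b v) = xact (a * b) v;
  xact1 : left_id 1 xact;
  xactDr : right_distributive xact +%R;
  xactDl : forall v, {morph xact^~ v : a b / a + b};
  xact_scalar : forall c v, xact (sub_scalar c) v = palg_scalar _ c *: v;
  xact_t : forall a v, xact (sub_t a) v = spin_t a *: v;
  xact_xi : forall i v, xact (sub_xi i) v = 0
}.

Section Induced.
Variables (V : lmodType spin_alg) (E : xi0_extension V).

Definition xi0_module of xi0_extension V : Type := V.

HB.instance Definition _ := GRing.Zmodule.on (xi0_module E).
HB.instance Definition _ := GRing.Zmodule_isLmodule.Build daha_sub
  (xi0_module E) (xactA E) (xact1 E) (xactDr E) (xactDl E).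

Definition induced : Type :=
  tensor (@subalg_incl _ _ _ daha_xi_gens) (xi0_module E).

(* [K[y_1, ..., y_n] (x)_K V]. *)
Local Notation V_K := (restrict (@palg_scalar K _ _ : {rmorphism K -> spin_alg}) V).

Definition poly_tensor : Type :=
  tensor (@mpolyC n K : {rmorphism K -> {mpoly K[n]}}) V_K.

Definition ind_tens (a : spin_daha) (w : V) : induced :=
  tens a (w : xi0_module E).

Definition poly_tens (f : {mpoly K[n]}) (w : V) : poly_tensor :=
  tens f (w : V_K).

(* The polynomial [f], seen as an element of the algebra. *)
Definition poly_elt (f : {mpoly K[n]}) : spin_daha :=
  \sum_(m <- msupp f) f@_m *: (\prod_(i < n) gen_y i ^+ m i : spin_daha).

Lemma poly_eltEw (f : {mpoly K[n]}) k : (msize f <= k)%N ->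
  poly_elt f =
  \sum_(m : 'X_{1..n < k}) f@_m *: (\prod_(i < n) gen_y i ^+ m i : spin_daha).
Proof.
move=> le_fk; set I : subFinType _ := 'X_{1..n < k}.
rewrite /poly_elt (big_mksub I) ?msupp_uniq //=; first last.
  by move=> x /msize_mdeg_lt /leq_trans; apply.
rewrite big_rmcond //= => j /memN_msupp_eq0 ->.
by rewrite scale0r.
Qed.

Lemma poly_eltD (f g : {mpoly K[n]}) : poly_elt (f + g) = poly_elt f + poly_elt g.
Proof.
pose k := maxn (msize (f + g)) (maxn (msize f) (msize g)).
rewrite !(@poly_eltEw _ k) /k ?leq_max ?leqnn ?orbT // -big_split /=.
by apply: eq_bigr => m _; rewrite mcoeffD scalerDl.
Qed.

Lemma poly_eltMC (f : {mpoly K[n]}) (c : K) : poly_elt (f * c%:MP) = c *: poly_elt f.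
Proof.
rewrite mulrC mul_mpolyC; pose k := maxn (msize (c *: f)) (msize f).
rewrite !(@poly_eltEw _ k) /k ?leq_max ?leqnn ?orbT // scaler_sumr.
by apply: eq_bigr => m _; rewrite mcoeffZ scalerA.
Qed.

(* The linear map from [K[y_1, ..., y_n] (x) V] to the induced module sending
   [f (x) w] to [f (x) w]; it is bijective by the PBW property. *)
Definition ident : poly_tensor -> induced :=
  tensor_lift (fun (f : {mpoly K[n]}) (w : V_K) =>
    ind_tens (poly_elt f) w).

Lemma ident_tens (f : {mpoly K[n]}) (w : V) :
  ident (poly_tens f w) = ind_tens (poly_elt f) w.
Proof.
apply: tensor_lift_tens => [a b v|a v1 v2|a c v].
- by rewrite poly_eltD; apply: tensDl.
- exact: tensDr.
- rewrite poly_eltMC -palg_scalar_central.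
  rewrite /ind_tens (tensM (phi := @subalg_incl _ _ _ daha_xi_gens)
    (W := xi0_module E) (poly_elt a) (sub_scalar c)).
  by congr (tens _ _); apply: xact_scalar.
Qed.

(* The action on [K[y_1, ..., y_n] (x) V] obtained from the induced module by
   transport along the identification: [circ a x] is the element corresponding
   to [a *: ident x]. *)
Definition circ (a : spin_daha) (x : poly_tensor) : poly_tensor :=
  xget 0 [set z | ident z = a *: ident x]%classic.

End Induced.
End SpinDAHA.

(* The quotient [p / d] of polynomials, when [d] is nonzero and divides [p]. *)
Definition mquot (K : comNzRingType) (n : nat) (p d : {mpoly K[n]}) :
  {mpoly K[n]} := xget 0 [set q | q * d = p]%classic.

(* Main.v *)
From HB Require Import structures.
Require Import Defs.
From mathcomp Require Import all_boot all_order all_algebra all_fingroup.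
From mathcomp Require Import boolp classical_sets reals finmap complex mpoly.
From mathcomp Require monalg.
From mathcomp Require Import zify.

Set Implicit Arguments.
Unset Strict Implicit.
Unset Printing Implicit Defensive.

Import GRing.Theory.
Local Open Scope ring_scope.

(** The action on [K[y_1, ..., y_n] (x) W] is transported from the induced
    module, where it is easily computed. The commutator of [y_j] and [xi_i] is a
    combination of brackets, and [[k, l]] sends [f (x) w] to
    [s_kl f (x) [k, l] w], because conjugation by the [t_a] permutes the [y_j].
    Since [xi_i] kills [1 (x) w], the value of [xi_i] on [f (x) w] follows by
    moving the variables of [f] to the left one at a time; the divided
    differences [(1 - s_ki) / (y_i - y_k)] obey the same twisted Leibniz rule
    ([divdiff_mulX]) and vanish on [1].

    The transport itself requires the identification to be injective, which is
    one half of the PBW property. It is obtained by constructing the expected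
    action beforehand: multiplications by the variables, the operators
    [s_a (x) t_a] and the spin Dunkl operators given by the formula of the
    theorem satisfy all the defining relations ([daha_rel_op]), hence define a
    representation [daha_repr] of the algebra on [K[y_1, ..., y_n] (x) W]. Then
    [a (x) w |-> a (1 (x) w)] is a left inverse of the identification
    ([identK]). The only delicate relation is the anticommutation of the spin
    Dunkl operators: their anticommutator commutes with all the [y_k]
    ([anticommutator_commutes]) and kills the [1 (x) w], hence is zero
    ([xi_anti]).

    Once the representation is available, the calculation described above is
    the statement that the identification commutes with the generators
    ([intertwined_gen], [ident_xi]), and the theorem follows. *)

(** * The ring of additive endomorphisms *)

Section AdditiveEndomorphisms.
Variable M : zmodType.

Record aend := AEnd { aend_fun :> M -> M; aend_zmod : zmod_morphism aend_fun }.

HB.instance Definition _ (f : aend) :=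
  GRing.isZmodMorphism.Build M M (aend_fun f) (aend_zmod f).

Lemma aendP (f g : aend) : f =1 g -> f = g.
Proof.
case: f g => f fP [g gP] /= /funext fg; subst g.
by congr AEnd; apply: Prop_irrelevance.
Qed.

HB.instance Definition _ := gen_eqMixin aend.
HB.instance Definition _ := gen_choiceMixin aend.

Program Definition aend0 := @AEnd (fun=> 0) _.
Next Obligation. by move=> x y; rewrite subr0. Qed.
Program Definition aendN (f : aend) := @AEnd (fun x => - f x) _.
Next Obligation. by move=> x y /=; rewrite raddfB opprB addrC opprK. Qed.
Program Definition aendD (f g : aend) := @AEnd (fun x => f x + g x) _.
Next Obligation. by move=> x y /=; rewrite !raddfB opprD addrACA. Qed.
Program Definition aend1 := @AEnd id _.
Next Obligation. by []. Qed.
Program Definition aendM (f g : aend) := @AEnd (fun x => f (g x)) _.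
Next Obligation. by move=> x y /=; rewrite !raddfB. Qed.

Lemma aend_addA : associative aendD.
Proof. by move=> f g h; apply: aendP => x; apply: addrA. Qed.
Lemma aend_addC : commutative aendD.
Proof. by move=> f g; apply: aendP => x; apply: addrC. Qed.
Lemma aend_add0 : left_id aend0 aendD.
Proof. by move=> f; apply: aendP => x; apply: add0r. Qed.
Lemma aend_addN : left_inverse aend0 aendN aendD.
Proof. by move=> f; apply: aendP => x; apply: addNr. Qed.

HB.instance Definition _ := GRing.isZmodule.Build aend
  aend_addA aend_addC aend_add0 aend_addN.

Lemma aend_mulA : associative aendM.
Proof. by move=> f g h; apply: aendP. Qed.
Lemma aend_mul1 : left_id aend1 aendM.
Proof. by move=> f; apply: aendP. Qed.
Lemma aend_mulr1 : right_id aend1 aendM.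
Proof. by move=> f; apply: aendP. Qed.
Lemma aend_mulDl : left_distributive aendM +%R.
Proof. by move=> f g h; apply: aendP. Qed.
Lemma aend_mulDr : right_distributive aendM +%R.
Proof. by move=> f g h; apply: aendP => x; apply: raddfD. Qed.

HB.instance Definition _ := GRing.Zmodule_isPzRing.Build aend
  aend_mulA aend_mul1 aend_mulr1 aend_mulDl aend_mulDr.

Lemma aendDE (f g : aend) x : (f + g) x = f x + g x. Proof. by []. Qed.
Lemma aendNE (f : aend) x : (- f) x = - f x. Proof. by []. Qed.
Lemma aendME (f g : aend) x : (f * g) x = f (g x). Proof. by []. Qed.
Lemma aend0E x : (0 : aend) x = 0. Proof. by []. Qed.
Lemma aend_sumE I (r : seq I) P (F : I -> aend) x :
  (\sum_(i <- r | P i) F i) x = \sum_(i <- r | P i) F i x.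
Proof. by elim/big_rec2: _ => // i y f _ <-. Qed.

End AdditiveEndomorphisms.

Definition scale_end (R : pzRingType) (V : lmodType R) (a : R) :
  aend V := AEnd (scalerBr a : zmod_morphism ( *:%R a : V -> V)).

Section ScaleEndomorphism.
Variables (R : pzRingType) (V : lmodType R).
Implicit Types (a b : R) (x : V).

Fact scale_end_is_zmod_morphism : zmod_morphism (scale_end V).
Proof. by move=> a b; apply: aendP => x; apply: scalerBl. Qed.

Fact scale_end_is_monoid_morphism : monoid_morphism (scale_end V).
Proof.
split; first by apply: aendP => x; apply: scale1r.
by move=> a b; apply: aendP => x; apply/esym/scalerA.
Qed.

HB.instance Definition _ := GRing.isZmodMorphism.Build R (aend V)
  (scale_end V) scale_end_is_zmod_morphism.
HB.instance Definition _ := GRing.isMonoidMorphism.Build R (aend V)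
  (scale_end V) scale_end_is_monoid_morphism.

End ScaleEndomorphism.

(** * Ring morphisms out of a presented algebra *)

Module FreeLift.
Import monalg.

(** The target is an arbitrary ring under [K], possibly zero: it will be a ring
    of endomorphisms of a module that may vanish. *)
Section FreeLift.
Variables (K : comNzRingType) (X : choiceType) (B : pzRingType).
Variables (c : {rmorphism K -> B}) (h : X -> B).

Definition free_word (k : {fmonom X}) : B := \prod_(x <- fmonom_val k) h x.

Definition free_lift (g : free_alg K X) : B :=
  \sum_(k <- enum_fset (msupp g)) c (mcoeff k g) * free_word k.

Lemma free_liftEw (g : free_alg K X) (D : {fset {fmonom X}}) :
  (msupp g `<=` D)%fset ->
  free_lift g = \sum_(k <- enum_fset D) c (mcoeff k g) * free_word k.
Proof.
move=> sgD; apply: big_fset_incl => // k _ /mcoeff_outdom ->.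
by rewrite rmorph0 mul0r.
Qed.

Lemma free_lift_is_zmod_morphism : zmod_morphism free_lift.
Proof.
move=> x y; pose D := (msupp x `|` msupp y)%fset.
rewrite (@free_liftEw (x - y) D) ?(@free_liftEw x D) ?(@free_liftEw y D)
  ?fsubsetUl ?fsubsetUr ?msuppB_le // -sumrB.
by apply: eq_bigr => k _; rewrite mcoeffB rmorphB mulrBl.
Qed.

HB.instance Definition _ := GRing.isZmodMorphism.Build
  (free_alg K X) B free_lift free_lift_is_zmod_morphism.

Lemma free_liftU (a : K) (k : {fmonom X}) :
  free_lift (mkmalgU k a : free_alg K X) = c a * free_word k.
Proof.
by rewrite (@free_liftEw _ [fset k]%fset) ?msuppU_le // big_seq_fset1 mcoeffUU.
Qed.

Lemma free_lift_gen (x : X) : free_lift (free_gen K x) = h x.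
Proof. by rewrite free_liftU /free_word fmuE big_seq1 rmorph1 mul1r. Qed.

Lemma free_lift_scalar (a : K) : free_lift (a%:A : free_alg K X) = c a.
Proof.
rewrite -(@mul_malgC (fmonom X) K a 1) mulr1 free_liftU.
by rewrite /free_word fm1 big_nil mulr1.
Qed.

Hypothesis ch : forall a x, GRing.comm (c a) (h x).

Lemma free_lift_is_monoid_morphism : monoid_morphism free_lift.
Proof.
split; first by rewrite -(scale1r 1) free_lift_scalar rmorph1.
move=> g1 g2; rewrite [g1 * g2](@malgME (fmonom X) K) !raddf_sum mulr_suml.
apply: eq_bigr => k _; rewrite raddf_sum mulr_sumr; apply: eq_bigr => l _.
rewrite [LHS]free_liftU rmorphM /free_word fmM big_cat /= -!mulrA.
congr (_ * _); rewrite !mulrA; congr (_ * _).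
by apply: commr_prod => x _; apply: ch.
Qed.

Definition free_lift_rmorphism : {rmorphism free_alg K X -> B} :=
  HB.pack free_lift
    (GRing.isZmodMorphism.Build (free_alg K X) B free_lift
       free_lift_is_zmod_morphism)
    (GRing.isMonoidMorphism.Build (free_alg K X) B free_lift
       free_lift_is_monoid_morphism).

End FreeLift.
End FreeLift.
Export FreeLift.

Section PresentedLift.
Variables (K : comNzRingType) (X : choiceType).
Variable rel : free_alg K X -> free_alg K X -> Prop.
Variables (B : pzRingType) (c : {rmorphism K -> B}) (h : X -> B).

Definition palg_lift (x : presented_alg rel) : B :=
  free_lift c h (generic_quotient.repr x).

Let palg_piK (x : presented_alg rel) :
  palg_pi rel (generic_quotient.repr x) = x.
Proof. exact: rquot_piK. Qed.

Hypothesis ch : forall a x, GRing.comm (c a) (h x).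
Hypothesis hrel : forall x y, rel x y -> free_lift c h x = free_lift c h y.

Lemma palg_lift_pi (x : free_alg K X) :
  palg_lift (palg_pi rel x) = free_lift c h x.
Proof.
have [L1 LM] := free_lift_is_monoid_morphism ch.
suff L0 y : ideal_gen rel y -> free_lift c h y = 0.
  apply/eqP; rewrite -subr_eq0 -raddfB; apply/eqP/L0/rquot_eqP.
  exact: rquot_piK.
elim=> [x1 x2 /hrel e||x1 x2 _ e1 _ e2|a b _ e|a b _ e].
- by rewrite raddfB /= e subrr.
- by rewrite raddf0.
- by rewrite raddfB /= e1 e2 subrr.
- by rewrite LM e mulr0.
- by rewrite LM e mul0r.
Qed.

Lemma palg_lift_is_zmod_morphism : zmod_morphism palg_lift.
Proof.
move=> x y; rewrite -(palg_piK x) -(palg_piK y).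
by rewrite -raddfB !palg_lift_pi raddfB.
Qed.

Lemma palg_lift_is_monoid_morphism : monoid_morphism palg_lift.
Proof.
have [L1 LM] := free_lift_is_monoid_morphism ch.
split=> [|x y]; first by rewrite -(rmorph1 (palg_pi rel)) palg_lift_pi.
rewrite -(palg_piK x) -(palg_piK y).
by rewrite -rmorphM !palg_lift_pi LM.
Qed.

Lemma palg_lift_gen x : palg_lift (palg_gen rel x) = h x.
Proof. by rewrite palg_lift_pi free_lift_gen. Qed.

Lemma palg_lift_scalar a : palg_lift (palg_scalar rel a) = c a.
Proof. by rewrite palg_lift_pi free_lift_scalar. Qed.

Definition palg_lift_rmorphism : {rmorphism presented_alg rel -> B} :=
  HB.pack palg_lift
    (GRing.isZmodMorphism.Build (presented_alg rel) B palg_lift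
       palg_lift_is_zmod_morphism)
    (GRing.isMonoidMorphism.Build (presented_alg rel) B palg_lift
       palg_lift_is_monoid_morphism).

End PresentedLift.

(** * Brackets and their equivariance *)

Lemma enum_interval_rcons (m i : nat) (a : 'I_m) : (i <= a)%N ->
  [seq b : 'I_m <- enum 'I_m | (i <= b < a.+1)%N] =
  rcons [seq b : 'I_m <- enum 'I_m | (i <= b < a)%N] a.
Proof.
move=> le_ia; apply: (inj_map val_inj); rewrite map_rcons.
rewrite -!(filter_map val (fun b => (i <= b < _)%N)) val_enum_ord.
have := ltn_ord a; rewrite -[val a]/(nat_of_ord a); move: (nat_of_ord a) le_ia.
move=> {}a le_ia lt_am; have -> : (m = a + (1 + (m - a.+1)))%N by lia.
rewrite iotaD filter_cat iotaD filter_cat /= add0n ltnSn le_ia /=.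
rewrite [in RHS]filter_cat /= ltnn andbF -cats1; congr (_ ++ _).
  rewrite [X in _ = _ ++ X](eq_in_filter (a2 := pred0)); last first.
    by move=> x; rewrite mem_iota /=; lia.
  rewrite filter_pred0 cats0; apply: eq_in_filter => x.
  by rewrite mem_iota /=; lia.
congr cons; rewrite (eq_in_filter (a2 := pred0)) ?filter_pred0 //.
by move=> x; rewrite mem_iota /=; lia.
Qed.

Lemma enum_interval0 (m i j : nat) : (j <= i)%N ->
  [seq b : 'I_m <- enum 'I_m | (i <= b < j)%N] = [::].
Proof.
move=> le_ji; rewrite (eq_filter (a2 := pred0)) ?filter_pred0 //.
by move=> b /=; lia.
Qed.

Section Bracket.
Variables (n : nat) (A : pzRingType) (t : 'I_n.-1 -> A).
Implicit Types (a b : 'I_n.-1) (i j k : 'I_n).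

Lemma bracketN i j : i != j -> bracket t i j = - bracket t j i.
Proof.
rewrite -val_eqE /bracket /=; case: ltngtP => //=.
by rewrite opprK.
Qed.

Lemma bracket_simple a i j : i = a :> nat -> j = a.+1 :> nat ->
  bracket t i j = t a.
Proof.
move=> ia ja; rewrite /bracket /bracket_lt ia ja ltnSn subSnn subnn expr0 mul1r.
rewrite -big_filter filter_rev enum_interval_rcons // enum_interval0 //=.
by rewrite -[X in _ * X]big_filter enum_interval0 // big_nil mulr1 big_seq1.
Qed.

(** Brackets are palindromes: raising the upper index by one conjugates by a
    generator. With [bracket_ind] this replaces the explicit products by a
    recursion on the upper index. *)
Lemma bracket_step a i j k : (i < j)%N -> j = a :> nat -> k = a.+1 :> nat ->
  bracket t i k = - (t a * bracket t i j * t a).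
Proof.
move=> ij ja ka; have ia : (i < a)%N by rewrite -ja.
rewrite /bracket ij ka ltnS (ltnW ia) /bracket_lt ka ja.
rewrite -!(big_filter _ (fun b => (i <= b < _)%N)).
rewrite -!(big_filter _ (fun b => (i < b < _)%N)) !filter_rev.
rewrite !enum_interval_rcons ?(ltnW ia) // rev_rcons big_cons.
rewrite -cats1 big_cat big_seq1 /=.
have -> : (a.+1 - i - 1 = (a - i - 1).+1)%N by lia.
by rewrite exprS mulN1r !mulNr; congr (- _); rewrite !mulrA commr_sign.
Qed.

Lemma bracket_ind (Q : 'I_n -> 'I_n -> Prop) :
  (forall a i j, i = a :> nat -> j = a.+1 :> nat -> Q i j) ->
  (forall a i j k, (i < j)%N -> j = a :> nat -> k = a.+1 :> nat ->
     Q i j -> Q i k) ->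
  forall i j, (i < j)%N -> Q i j.
Proof.
move=> Q1 QS i [j ltjn] /=; elim: j ltjn => // j IHj ltjn.
have ltj : (j < n)%N by exact: ltnW.
have ltj1 : (j < n.-1)%N by lia.
rewrite ltnS leq_eqVlt => /orP[/eqP eij|ltij].
  exact: (Q1 (Ordinal ltj1) i (Ordinal ltjn) eij erefl).
exact: (QS (Ordinal ltj1) i (Ordinal ltj) (Ordinal ltjn) ltij erefl erefl
  (IHj ltj ltij)).
Qed.

End Bracket.

Lemma bracket_rmorph (n : nat) (A B : pzRingType) (phi : {rmorphism A -> B})
  (t : 'I_n.-1 -> A) i j : phi (bracket t i j) = bracket (phi \o t) i j.
Proof.
have lt p q : phi (bracket_lt t p q) = bracket_lt (phi \o t) p q.
  by rewrite /bracket_lt !rmorphM /= rmorph_sign !rmorph_prod.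
by rewrite /bracket; case: ifP => _; rewrite ?rmorphN lt.
Qed.

Section SimpleTperm.
Variables (n : nat) (a : 'I_n.-1).
Implicit Types (i j k : 'I_n).

Lemma ltn_ord_pred : (a < n)%N. Proof. by have := ltn_ord a; lia. Qed.
Lemma ltnS_ord_pred : (a.+1 < n)%N. Proof. by have := ltn_ord a; lia. Qed.

Definition simple_tperm : 'S_n :=
  tperm (Ordinal ltn_ord_pred) (Ordinal ltnS_ord_pred).

Lemma simple_tpermE i j : i = a :> nat -> j = a.+1 :> nat ->
  simple_tperm = tperm i j.
Proof. by move=> ia ja; congr tperm; apply: val_inj; rewrite /= ?ia ?ja. Qed.

Lemma simple_tperm_fix i : i != a :> nat -> i != a.+1 :> nat ->
  simple_tperm i = i.
Proof. by move=> ia ja; rewrite tpermD // -val_eqE /= eq_sym. Qed.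

End SimpleTperm.

Lemma simple_tperm_braid (n : nat) (a b : 'I_n.-1) : b = a.+1 :> nat ->
  (simple_tperm a * simple_tperm b * simple_tperm a =
   simple_tperm b * simple_tperm a * simple_tperm b)%g.
Proof.
move=> ba; pose i := Ordinal (ltn_ord_pred a).
pose j := Ordinal (ltn_ord_pred b).
pose k := Ordinal (ltnS_ord_pred b).
have -> : simple_tperm a = tperm i j by apply: simple_tpermE.
have -> : simple_tperm b = tperm j k by [].
have ij : i != j by rewrite -val_eqE /=; lia.
have ik : i != k by rewrite -val_eqE /=; lia.
have jk : j != k by rewrite -val_eqE /=; lia.
have : (tperm j k ^ tperm i j = tperm i j ^ tperm j k)%g.
  by rewrite !tpermJ tpermL tpermR !tpermD // eq_sym.
by rewrite !conjgE !tpermV !mulgA => ->.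
Qed.

Lemma simple_tperm_far (n : nat) (a b : 'I_n.-1) :
  (a.+1 < b)%N || (b.+1 < a)%N ->
  (simple_tperm a * simple_tperm b = simple_tperm b * simple_tperm a)%g.
Proof.
move=> ab; rewrite conjgC /simple_tperm tpermJ !tpermD //;
  by rewrite -val_eqE /=; lia.
Qed.

Section SpinRelations.
Variables (n : nat) (A : pzRingType) (t : 'I_n.-1 -> A).
Hypothesis spin_t_rel : forall l r, spin_rel t l r -> l = r.
Implicit Types (a b : 'I_n.-1) (i j k : 'I_n).

Let tK a : t a * t a = 1. Proof. exact/spin_t_rel/spin_sqr. Qed.
Let tKl a x : t a * (t a * x) = x. Proof. by rewrite mulrA tK mul1r. Qed.
Let braid a b : b = a.+1 :> nat -> t a * (t b * t a) = t b * (t a * t b).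
Proof. by move=> h; rewrite !mulrA; apply/spin_t_rel/spin_braid. Qed.
Let tfar a b : (a.+1 < b)%N || (b.+1 < a)%N -> t a * t b = - (t b * t a).
Proof. by move=> h; apply/spin_t_rel/spin_far. Qed.

Let braidl a b x : b = a.+1 :> nat ->
  t a * (t b * (t a * x)) = t b * (t a * (t b * x)).
Proof. by move=> h; have := congr1 ( *%R^~ x) (braid h); rewrite -!mulrA. Qed.

(** A bracket is a product of an odd number of generators, each of which
    contributes a sign. *)
Lemma bracket_far a i j : (i < j)%N -> (j < a)%N || (a.+1 < i)%N ->
  t a * bracket t i j = - (bracket t i j * t a).
Proof.
move: i j; apply: bracket_ind => [b i j ib jb h|b i j k ij jb kb IH h].
  by rewrite (bracket_simple _ ib jb) tfar //; lia.
have fab : t a * t b = - (t b * t a) by rewrite tfar //; lia.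
have fba : t b * t a = - (t a * t b) by rewrite fab opprK.
rewrite (bracket_step _ ij jb kb) mulrN mulNr !mulrA fab !mulNr.
rewrite -[in LHS](mulrA (t b)) IH ?mulrN ?mulNr; last by lia.
by rewrite -!mulrA fba !mulrN !mulrA.
Qed.

(** In the critical case [j = a.+2] the bracket is
    [t_(a+1) t_a X t_a t_(a+1)], where [X] anticommutes with [t_(a+1)]: the
    braid relation turns [t_a] into [t_(a+1)] on the left of [X] and back on
    its right. *)
Lemma bracket_inner a i j : (i < a)%N -> (a.+1 < j)%N ->
  t a * bracket t i j = - (bracket t i j * t a).
Proof.
move=> ia aj; have : (i < j)%N by lia.
move: i j ia aj; suff H i j : (i < j)%N -> (i < a)%N -> (a.+1 < j)%N ->
  t a * bracket t i j = - (bracket t i j * t a) by move=> *; apply: H.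
move: i j; apply: bracket_ind => [b i j|b i j k ij jb kb IH ia ak]; first lia.
rewrite (bracket_step _ ij jb kb); case: (ltnP a.+1 j) => aj.
  have fab : t a * t b = - (t b * t a) by rewrite tfar //; lia.
  have fba : t b * t a = - (t a * t b) by rewrite fab opprK.
  rewrite mulrN mulNr !mulrA fab !mulNr -[in LHS](mulrA (t b)) IH //.
  by rewrite mulrN mulNr -!mulrA fba !mulrN !mulrA.
have ba : b = a.+1 :> nat by lia.
pose j' := Ordinal (ltn_ord_pred a).
have ij' : (i < j')%N by [].
rewrite (bracket_step _ ij' (erefl _) (_ : j = a.+1 :> nat)); last by lia.
set X := bracket t i j'.
have bX : t b * X = - (X * t b) by apply: bracket_far => //=; lia.
have bXl x : t b * (X * x) = - (X * (t b * x)) by rewrite !mulrA bX mulNr.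
rewrite !(mulrN, mulNr, opprK) -!mulrA braidl // bXl !mulrN.
by rewrite -(braid ba).
Qed.

Lemma bracket_bottom a i i' j :
  (i' < j)%N -> i = a :> nat -> i' = a.+1 :> nat ->
  t a * bracket t i j = - (bracket t i' j * t a).
Proof.
move=> lt_i'j ia i'a; move: i' j lt_i'j i'a.
apply: bracket_ind => [b i' j ib jb|b i' j k ij jb kb IH] i'a.
  have ii' : (i < i')%N by rewrite ia i'a.
  rewrite (bracket_step _ ii' ib jb) (bracket_simple _ ia i'a).
  rewrite (bracket_simple _ ib jb) mulrN -!mulrA braidl ?tK ?mulr1 //.
  by rewrite -ib.
have ij' : (i < j)%N by lia.
have fab : t a * t b = - (t b * t a) by rewrite tfar //; lia.
have fba : t b * t a = - (t a * t b) by rewrite fab opprK.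
rewrite (bracket_step _ ij' jb kb) (bracket_step _ ij jb kb).
rewrite mulrN mulNr !mulrA fab !mulNr -[in LHS](mulrA (t b)) IH //.
by rewrite mulrN mulNr -!mulrA fba !mulrN !mulrA.
Qed.

(** The equivariance that makes the spin Dunkl operators transform under the
    generators as the [xi_i] do. When [a] or [a.+1] is an index of the bracket,
    it is the recursion of [bracket_step] or its mirror image
    [bracket_bottom]; otherwise the transposition fixes both indices. *)
Lemma mul_simple_bracket a i j : i != j ->
  t a * bracket t i j =
  - (bracket t (simple_tperm a i) (simple_tperm a j) * t a).
Proof.
set s := simple_tperm a.
wlog ij : i j / (i < j)%N.
  move=> H ij; case: (ltnP i j) => [|ji]; first by move/H; apply.
  have {}ji : (j < i)%N by rewrite ltn_neqAle ji eq_sym ij.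
  rewrite bracketN // mulrN H 1?eq_sym // opprK bracketN ?mulNr ?opprK //.
  by rewrite (inj_eq perm_inj) eq_sym.
move=> _; pose i0 := Ordinal (ltn_ord_pred a).
pose i1 := Ordinal (ltnS_ord_pred a).
have [ia|ia] := eqVneq (i : nat) a.
  have ei : i = i0 by apply: val_inj.
  rewrite ei /s /simple_tperm tpermL.
  have [ja|ja] := eqVneq (j : nat) a.+1.
    have -> : j = i1 by apply: val_inj.
    rewrite tpermR [bracket t i1 i0]bracketN; last by rewrite -val_eqE /=; lia.
    by rewrite (bracket_simple t (erefl _ : i0 = a :> nat)) // mulNr opprK.
  rewrite tpermD -?val_eqE /=; try lia.
  by apply: bracket_bottom => //=; lia.
have [ja|ja] := eqVneq (j : nat) a.
  have -> : j = i0 by apply: val_inj.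
  have ia' : (i < i0)%N by rewrite /= -ja.
  rewrite /s simple_tperm_fix //; last by lia.
  rewrite /simple_tperm tpermL (@bracket_step _ _ _ a i i0 i1 ia') //.
  by rewrite mulNr opprK -!mulrA tK mulr1.
have [ia1|ia1] := eqVneq (i : nat) a.+1.
  have ei : i = i1 by apply: val_inj.
  have -> : s j = j by apply: simple_tperm_fix; lia.
  rewrite ei /s /simple_tperm tpermR.
  have h := @bracket_bottom a i0 i1 j _ erefl erefl.
  apply: (can_inj (tKl a)).
  rewrite tKl mulrN !mulrA h ?mulNr ?opprK -?mulrA ?tK ?mulr1 //=; lia.
have [ja1|ja1] := eqVneq (j : nat) a.+1.
  have -> : j = i1 by apply: val_inj.
  have -> : s i = i by apply: simple_tperm_fix.
  have ia' : (i < i0)%N by rewrite /=; lia.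
  rewrite /s /simple_tperm tpermR (@bracket_step _ _ _ a i i0 i1 ia') //.
  by rewrite mulrN -mulrA tKl.
rewrite /s !simple_tperm_fix //.
have [ha|ha] := boolP ((i < a)%N && (a.+1 < j)%N).
  by case/andP: ha => *; apply: bracket_inner.
by apply: bracket_far => //; lia.
Qed.

(** The rule for the generators propagates to the brackets since these are
    products of an odd number of generators, whose simple transpositions
    multiply to [s_ij]. *)
Lemma bracket_intertwine (x : 'I_n -> A) :
  (forall a i, t a * x i = - (x (simple_tperm a i) * t a)) ->
  forall i j k, i != j ->
  bracket t i j * x k = - (x (tperm i j k) * bracket t i j).
Proof.
move=> tx i j k; wlog: i j / (i < j)%N => [H ij|ij _].
  case: (ltnP i j) => [/H|ji]; first by apply.
  have {}ji : (j < i)%N by rewrite ltn_neqAle ji eq_sym ij.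
  by rewrite bracketN // mulNr H 1?eq_sym // tpermC mulrN.
have txl a l y : t a * (x l * y) = - (x (simple_tperm a l) * (t a * y)).
  by rewrite mulrA tx mulNr mulrA.
move: i j ij k.
apply: bracket_ind => [a i j ia ja k|a i j k ij ja ka IH l].
  by rewrite (bracket_simple _ ia ja) tx (simple_tpermE ia ja).
have IHl m y : bracket t i j * (x m * y) =
    - (x (tperm i j m) * (bracket t i j * y)) by rewrite mulrA IH mulNr mulrA.
rewrite (bracket_step _ ij ja ka) mulNr mulrN -!mulrA tx !mulrN IHl mulrN txl.
rewrite !opprK (simple_tpermE ja ka); congr (x _ * _).
have -> : tperm i k = (tperm i j ^ tperm j k)%g.
  by rewrite tpermJ tpermL tpermD // -val_eqE /=; lia.
by rewrite /conjg tpermV !permM.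
Qed.

End SpinRelations.

(** * Divided differences *)

Lemma mpoly_gen_ind (K : comNzRingType) (n : nat) (P : {mpoly K[n]} -> Prop) :
  (forall f g, P f -> P g -> P (f + g)) -> (forall c f, P f -> P (c *: f)) ->
  P 1 -> (forall i f, P f -> P ('X_i * f)) -> forall f, P f.
Proof.
move=> PD PZ P1 PX.
have P0 : P 0 by rewrite -(scale0r 1); apply: PZ.
have PXn i m f : P f -> P ('X_i ^+ m * f).
  move=> Pf; elim: m => [|m IH]; first by rewrite mul1r.
  by rewrite exprS -mulrA; apply: PX.
apply: mpolyind => // c m f _ _ Pf; apply: PD => //; apply: PZ.
rewrite mpolyXE_id; elim/big_rec: _ => // i g _; exact: PXn.
Qed.

Section DividedDifference.
Variables (K : idomainType) (n : nat).
Local Notation P := {mpoly K[n]}.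
Implicit Types (i j k : 'I_n) (f g : P) (s : 'S_n).

Lemma msymU s i : msym s 'X_i = 'X_(s i) :> P.
Proof. by rewrite /msym mmapX mmap1U. Qed.

Lemma mpolyX_sub_neq0 i k : k != i -> 'X_i - 'X_k != 0 :> P.
Proof.
move=> ki; rewrite subr_eq0; apply: contra_neq ki => /(congr1 (mcoeff U_(i))).
rewrite !mcoeffX eqxx; case: eqVneq => [|_ /eqP]; last by rewrite oner_eq0.
move=> /(congr1 (fun m : 'X_{1..n} => m i)); rewrite !mnm1E eqxx.
by case: eqP.
Qed.

(** Quotients by [y_i - y_k] are unique, so that identities between divided
    differences can be checked after multiplication by [y_i - y_k]. *)
Lemma mpolyX_subI i k : k != i ->
  injective (fun f : P => f * ('X_i - 'X_k)).
Proof. by move=> ki; apply/mulIf/mpolyX_sub_neq0. Qed.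

(** The divided difference of the variable [y_j], when [k != i]. *)
Definition swap_sign (k i j : 'I_n) : P := (j == i)%:R - (j == k)%:R.

Lemma swap_signP k i j : k != i ->
  swap_sign k i j * ('X_i - 'X_k) = 'X_j - 'X_(tperm k i j).
Proof.
move=> ki; rewrite /swap_sign; case: tpermP => [->|->|/eqP jk /eqP ji].
- by rewrite (negPf ki) eqxx sub0r mulN1r opprB.
- by rewrite eqxx eq_sym (negPf ki) subr0 mul1r.
- by rewrite (negPf jk) (negPf ji) subrr mul0r subrr.
Qed.

(** The quotient for ['X_j * f] is dictated by the twisted Leibniz rule
    [divdiff_mulX]. *)
Lemma swap_divides k i f : k != i ->
  exists q, q * ('X_i - 'X_k) = f - msym (tperm k i) f.
Proof.
move=> ki; elim/mpoly_gen_ind: f => [f g [p pE] [q qE]|c f [q qE]||j f [q qE]].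
- by exists (p + q); rewrite mulrDl pE qE msymD opprD addrACA.
- by exists (c *: q); rewrite -scalerAl qE msymZ scalerBr.
- by exists 0; rewrite mul0r msym1 subrr.
- exists ('X_j * q + swap_sign k i j * msym (tperm k i) f).
  rewrite mulrDl -mulrA qE mulrAC swap_signP // msymM msymU.
  by rewrite mulrBr mulrBl addrA subrK.
Qed.

(** At [k = i] the quotient [mquot 0 0] would be arbitrary; the value [0] keeps
    the operator linear for all indices. *)
Definition divdiff (k i : 'I_n) (f : P) : P :=
  if k == i then 0 else mquot (f - msym (tperm k i) f) ('X_i - 'X_k).

Lemma divdiffE k i f : k != i ->
  divdiff k i f = mquot (f - msym (tperm k i) f) ('X_i - 'X_k).
Proof. by rewrite /divdiff => /negPf ->. Qed.

Lemma divdiffP k i f :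
  divdiff k i f * ('X_i - 'X_k) = f - msym (tperm k i) f.
Proof.
rewrite /divdiff; case: eqVneq => [->|ki].
  by rewrite tperm1 msym1m !subrr mulr0.
have [q qP] := swap_divides f ki.
by rewrite /mquot; case: xgetP => [_ _ //|/(_ q)].
Qed.

Lemma divdiff_is_linear k i : linear (divdiff k i).
Proof.
move=> c f g; have [->|ki] := eqVneq k i.
  by rewrite /divdiff eqxx scaler0 addr0.
apply: (mpolyX_subI ki); rewrite /= mulrDl -scalerAl !divdiffP.
by rewrite msymD msymZ scalerBr opprD addrACA.
Qed.

HB.instance Definition _ k i :=
  GRing.isLinear.Build K P P *:%R (divdiff k i) (divdiff_is_linear k i).

Lemma divdiff1 k i : divdiff k i 1 = 0.
Proof.
have [->|ki] := eqVneq k i; first by rewrite /divdiff eqxx.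
by apply: (mpolyX_subI ki); rewrite /= divdiffP msym1 subrr mul0r.
Qed.

Lemma divdiff_mulX k i j f : k != i ->
  divdiff k i ('X_j * f) =
  'X_j * divdiff k i f + swap_sign k i j * msym (tperm k i) f.
Proof.
move=> ki; apply: (mpolyX_subI ki); rewrite /= divdiffP mulrDl -mulrA divdiffP.
by rewrite mulrAC swap_signP // msymM msymU mulrBr mulrBl addrA subrK.
Qed.

Lemma msym_divdiff s k i f :
  msym s (divdiff k i f) = divdiff (s k) (s i) (msym s f).
Proof.
have [->|ki] := eqVneq k i; first by rewrite /divdiff !eqxx msym0.
have ski : s k != s i by rewrite (inj_eq perm_inj).
apply: (mpolyX_subI ski); rewrite /= divdiffP -!msymU -msymB -msymM divdiffP.
by rewrite msymB -!msymMm -tpermJ -conjgC.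
Qed.

End DividedDifference.

(** * Operators on the tensor product *)

Lemma spin_rel_image (n : nat) (A B : pzRingType) (phi : {rmorphism A -> B})
    (t : 'I_n.-1 -> A) (t' : 'I_n.-1 -> B) :
  (forall a, t' a = phi (t a)) ->
  (forall l r, spin_rel t l r -> phi l = phi r) ->
  forall l r, spin_rel t' l r -> l = r.
Proof.
move=> t'E phiE l r [a|a b ab|a b ab]; rewrite !t'E -!rmorphM.
- by rewrite -(rmorph1 phi); apply/phiE/spin_sqr.
- exact/phiE/spin_braid.
- by rewrite -rmorphN; apply/phiE/spin_far.
Qed.

Lemma spin_rel_morph (n : nat) (A B : pzRingType) (phi : {rmorphism A -> B})
    (t : 'I_n.-1 -> A) (t' : 'I_n.-1 -> B) :
  (forall a, phi (t a) = t' a) ->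
  (forall l r, spin_rel t' l r -> l = r) ->
  forall l r, spin_rel t l r -> phi l = phi r.
Proof.
move=> phit t'E l r [a|a b ab|a b ab]; rewrite ?rmorphN !rmorphM !phit.
- by rewrite rmorph1; apply/t'E/spin_sqr.
- exact/t'E/spin_braid.
- exact/t'E/spin_far.
Qed.

Section PolynomialRepresentation.
Variables (K : idomainType) (n : nat) (W : lmodType (spin_alg K n)).
Local Notation P := {mpoly K[n]}.
Local Notation PW := (poly_tensor W).
Implicit Types (i j k : 'I_n) (a b : 'I_n.-1) (f g : P) (w : W).

Lemma spin_t_rel l r : spin_rel (@spin_t K n) l r -> l = r.
Proof.
apply: (spin_rel_image (phi := palg_pi _) (t := fun a => free_gen K a)) => //.
by move=> {}l {}r h; apply/rquot_eqP/ideal_gen_rel.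
Qed.

Lemma spin_scaleC (c : K) (x : spin_alg K n) w :
  palg_scalar _ c *: (x *: w) = x *: (palg_scalar _ c *: w).
Proof.
have h : palg_scalar _ c * x = x * palg_scalar _ c.
  exact/esym/palg_scalar_central.
exact: etrans (scalerA _ _ _) (etrans (congr1 ( *:%R^~ w) h)
  (esym (scalerA _ _ _))).
Qed.

Lemma poly_tens_scale (c : K) f w :
  poly_tens (c *: f) w = poly_tens f (palg_scalar _ c *: w).
Proof. by rewrite -mul_mpolyC mulrC; apply: tensM. Qed.

Lemma poly_tensDl f g w : poly_tens (f + g) w = poly_tens f w + poly_tens g w.
Proof. exact: tensDl. Qed.

Lemma poly_tensDr f v w : poly_tens f (v + w) = poly_tens f v + poly_tens f w.
Proof. exact: tensDr. Qed.

Lemma poly_tens_mul f g w : f *: poly_tens g w = poly_tens (f * g) w.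
Proof. exact: tensor_scale_tens. Qed.

Lemma poly_tens_ext (F G : aend PW) :
  (forall f w, F (poly_tens f w) = G (poly_tens f w)) -> F = G.
Proof. by move=> FG; apply: aendP; apply: eq_tensor_additive. Qed.

(** The endomorphism [phi (x) x] is well defined because the scalars are central
    in the spin symmetric group algebra. *)
Section TensorMap.
Variables (phi : {linear P -> P}) (x : spin_alg K n).

Let g f w : PW := poly_tens (phi f) (x *: w).
Let gDl f1 f2 w : g (f1 + f2) w = g f1 w + g f2 w.
Proof. by rewrite /g linearD poly_tensDl. Qed.
Let gDr f v w : g f (v + w) = g f v + g f w.
Proof. by rewrite /g scalerDr poly_tensDr. Qed.
Let gM f c w : g (f * c%:MP) w = g f (palg_scalar _ c *: w).
Proof.
rewrite /g mulrC mul_mpolyC linearZ poly_tens_scale; congr (poly_tens _ _).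
exact: spin_scaleC.
Qed.

Definition tensor_map : aend PW := AEnd (tensor_lift_is_zmod_morphism
  (W := Defs.restrict (@palg_scalar K _ _ : {rmorphism K -> spin_alg K n}) W)
  gDl gDr gM).

Lemma tensor_mapE f w :
  tensor_map (poly_tens f w) = poly_tens (phi f) (x *: w).
Proof.
exact: (tensor_lift_tens
  (W := Defs.restrict (@palg_scalar K _ _ : {rmorphism K -> spin_alg K n}) W)
  gDl gDr gM).
Qed.

End TensorMap.
End PolynomialRepresentation.

(** * The relations of the spin Dunkl operators *)

(** Writing [c_ki] for the commutator of [y_k] and [x_i], and braces for
    anticommutators, the Leibniz rule gives
    [y_k {x_i, x_j} - {x_i, x_j} y_k = {c_ki, x_j} + {c_kj, x_i}].
    A term [br p q] with [p] and [q] different from [r] anticommutes with [x_r].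
    For [k] different from [i] and [j] all terms vanish in this way; for [k = i]
    there remain [{br i j, x_j}] and [{br i j, x_i}], which cancel since
    [br i j] exchanges [x_i] and [x_j] up to a sign. *)
Lemma anticommutator_commutes (B : pzRingType) (n : nat) (U : B)
    (y x : 'I_n -> B) (br : 'I_n -> 'I_n -> B) :
  (forall i, GRing.comm U (x i)) ->
  (forall i j k, i != j -> br i j * x k = - (x (tperm i j k) * br i j)) ->
  (forall i j, i != j -> y i * x j - x j * y i = U * br i j) ->
  (forall i, y i * x i - x i * y i = U * \sum_(k | k != i) br i k) ->
  forall k i j, i != j -> GRing.comm (y k) (x i * x j + x j * x i).
Proof.
move=> Ux brx yx yxx k i j.
pose c p q := y p * x q - x q * y p.
have Ubr p q r : p != q ->
    U * br p q * x r = - (x (tperm p q r) * (U * br p q)).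
  by move=> pq; rewrite -mulrA brx // mulrN !mulrA Ux.
pose anti (b z : B) := b * z + z * b.
have antiDl b1 b2 z : anti (b1 + b2) z = anti b1 z + anti b2 z.
  by rewrite /anti mulrDl mulrDr addrACA.
have leibniz p q : y k * (x p * x q) - (x p * x q) * y k =
    c k p * x q + x p * c k q.
  by rewrite /c mulrBl mulrBr !mulrA addrA subrK.
have off p q r : p != q -> r != p -> r != q -> anti (U * br p q) (x r) = 0.
  move=> pq rp rq; rewrite /anti Ubr // tpermD 1?eq_sym //.
  by rewrite addNr.
suff anti0 p q : p != q -> anti (c k p) (x q) + anti (c k q) (x p) = 0.
  move=> ij; apply/eqP; rewrite -subr_eq0 mulrDr mulrDl opprD addrACA !leibniz.
  apply/eqP; rewrite -(anti0 _ _ ij) /anti addrACA.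
  by rewrite [x i * _ + _]addrC addrACA.
wlog kq : p q / k != q => [H pq|].
  have [kq|kq] := eqVneq k q; last exact: H.
  by rewrite addrC (H q p) ?kq // eq_sym.
move=> pq; have [kp|kp] := eqVneq k p; last first.
  by rewrite /c !yx // !off ?addr0 // eq_sym.
rewrite kp /c yxx (yx p q) // (bigD1 q) 1?eq_sym //= mulrDr.
set D := \sum_(l | _) _.
have D0 : anti (U * D) (x q) = 0.
  rewrite /anti /D mulr_sumr mulr_suml mulr_sumr -big_split big1 //= => l.
  by case/andP=> lp lq; apply: off; rewrite // eq_sym.
rewrite antiDl D0 addr0 /anti.
rewrite !Ubr // tpermL tpermR addrACA.
by rewrite [x q * _ + _]addrC addrACA !addNr addr0.
Qed.

(** The relations only depend on the following features of the tensor product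
    [P (x) W]: additive endomorphisms are determined by their values on the pure
    tensors [tn f w], on which polynomials and the operators [phi (x) x] act as
    expected. *)
Section SpinDunklOperators.
Variables (K : idomainType) (n : nat) (S : pzRingType) (W : lmodType S).
Local Notation P := {mpoly K[n]}.
Variables (u : K) (t : 'I_n.-1 -> S).
Hypothesis t_rel : forall l r, spin_rel t l r -> l = r.
Variables (M : zmodType) (tn : P -> W -> M).
Hypothesis tnDl : forall f g w, tn (f + g) w = tn f w + tn g w.
Hypothesis tnDr : forall f v w, tn f (v + w) = tn f v + tn f w.
Hypothesis tn_ext : forall F G : aend M,
  (forall f w, F (tn f w) = G (tn f w)) -> F = G.
Variable mul_op : {rmorphism P -> aend M}.
Hypothesis mul_opE : forall f g w, mul_op f (tn g w) = tn (f * g) w.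
Variable map_op : {linear P -> P} -> S -> aend M.
Hypothesis map_opE : forall phi x f w,
  map_op phi x (tn f w) = tn (phi f) (x *: w).
Implicit Types (i j k : 'I_n) (a b : 'I_n.-1) (f g : P) (v w : W).

Lemma tn0l w : tn 0 w = 0.
Proof. by apply: (addrI (tn 0 w)); rewrite -tnDl !addr0. Qed.
Lemma tn0r f : tn f 0 = 0.
Proof. by apply: (addrI (tn f 0)); rewrite -tnDr !addr0. Qed.
Lemma tnNl f w : tn (- f) w = - tn f w.
Proof. by apply: (addrI (tn f w)); rewrite -tnDl !subrr tn0l. Qed.
Lemma tnNr f w : tn f (- w) = - tn f w.
Proof. by apply: (addrI (tn f w)); rewrite -tnDr !subrr tn0r. Qed.

Definition scalar_op : {rmorphism K -> aend M} := mul_op \o (@mpolyC n K).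

Lemma scalar_opE c f w : scalar_op c (tn f w) = tn (c *: f) w.
Proof. by rewrite /= mul_opE mul_mpolyC. Qed.

Definition y_op i : aend M := mul_op 'X_i.
Definition t_op a : aend M := map_op (msym (simple_tperm a)) (t a).
Definition xi_op i : aend M :=
  scalar_op u * \sum_(k | k != i) map_op (divdiff k i) (bracket t k i).

Lemma y_opE i f w : y_op i (tn f w) = tn ('X_i * f) w.
Proof. exact: mul_opE. Qed.

Lemma t_opE a f w :
  t_op a (tn f w) = tn (msym (simple_tperm a) f) (t a *: w).
Proof. exact: map_opE. Qed.

Lemma xi_opE i f w : xi_op i (tn f w) = scalar_op u
  (\sum_(k | k != i) tn (divdiff k i f) (bracket t k i *: w)).
Proof.
rewrite aendME aend_sumE; congr (scalar_op u _).
by apply: eq_bigr => k _; apply: map_opE.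
Qed.

Lemma mul_op_comm f g : GRing.comm (mul_op f) (mul_op g).
Proof. by rewrite /GRing.comm -!rmorphM mulrC. Qed.

Lemma scalar_map_op c phi x : GRing.comm (scalar_op c) (map_op phi x).
Proof.
apply: tn_ext => f w.
by rewrite !aendME map_opE !scalar_opE map_opE linearZ.
Qed.

Lemma scalar_y c i : GRing.comm (scalar_op c) (y_op i).
Proof. exact: mul_op_comm. Qed.
Lemma scalar_t c a : GRing.comm (scalar_op c) (t_op a).
Proof. exact: scalar_map_op. Qed.
Lemma scalar_xi c i : GRing.comm (scalar_op c) (xi_op i).
Proof.
apply: commrM; first exact: mul_op_comm.
by apply: commr_sum => k _; apply: scalar_map_op.
Qed.

Lemma xi_op1 i w : xi_op i (tn 1 w) = 0.
Proof. by rewrite xi_opE big1 ?raddf0 // => k _; rewrite divdiff1 tn0l. Qed.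

Lemma t_op1 a w : t_op a (tn 1 w) = tn 1 (t a *: w).
Proof. by rewrite t_opE msym1. Qed.

Lemma t_op_rel l r : spin_rel t_op l r -> l = r.
Proof.
case=> [a|a b ab|a b ab]; apply: tn_ext => f w;
  rewrite ?aendNE !aendME !t_opE !scalerA -?msymMm.
- by rewrite (t_rel (spin_sqr _ a)) scale1r tperm2 msym1m.
- by rewrite (t_rel (spin_braid _ ab)) !mulgA simple_tperm_braid.
- by rewrite (t_rel (spin_far _ ab)) (simple_tperm_far ab) scaleNr tnNr.
Qed.

(** Both sides obey the recursion of [bracket_step], the transpositions being
    conjugated by [s_a]. *)
Lemma bracket_op i j : i != j ->
  bracket t_op i j = map_op (msym (tperm i j)) (bracket t i j).
Proof.
wlog: i j / (i < j)%N => [H ij|ij _].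
  case: (ltnP i j) => [/H|ji]; first by apply.
  have {}ji : (j < i)%N by rewrite ltn_neqAle ji eq_sym ij.
  rewrite bracketN // H 1?eq_sym // (bracketN t ij) tpermC.
  by apply: tn_ext => f w; rewrite aendNE !map_opE scaleNr tnNr.
move: i j ij; apply: bracket_ind => [a i j ia ja|a i j k ij ja ka IH].
  by rewrite !(bracket_simple _ ia ja) -(simple_tpermE ia ja).
rewrite !(bracket_step _ ij ja ka) IH; apply: tn_ext => f w.
rewrite aendNE !aendME t_opE map_opE t_opE map_opE scaleNr tnNr !scalerA.
congr (- tn _ _); rewrite -!msymMm (simple_tpermE ja ka) mulgA.
have -> : tperm i k = (tperm i j ^ tperm j k)%g.
  by rewrite tpermJ tpermL tpermD // -val_eqE /=; lia.
by rewrite conjgE tpermV mulgA.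
Qed.

Lemma t_y a i : t_op a * y_op i = y_op (simple_tperm a i) * t_op a.
Proof.
by apply: tn_ext => f w; rewrite !aendME t_opE !y_opE t_opE msymM msymU.
Qed.

Lemma t_xi a i : t_op a * xi_op i = - (xi_op (simple_tperm a i) * t_op a).
Proof.
apply: tn_ext => f w; rewrite aendNE [LHS]aendME [X in _ = - X]aendME.
rewrite t_opE !xi_opE -[LHS]aendME -scalar_t aendME -raddfN raddf_sum -sumrN.
congr (scalar_op u _).
rewrite [RHS](reindex_inj (@perm_inj _ (simple_tperm a))) /=.
apply: eq_big => [k|k ki]; first by rewrite (inj_eq perm_inj).
rewrite t_opE msym_divdiff -tnNr -scaleNr !scalerA; congr tn.
by rewrite mulNr mul_simple_bracket.
Qed.

(** In the twisted Leibniz rule of the divided differences only the transposed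
    term survives in the commutator. *)
Lemma y_xi_tens i j f w :
  (y_op i * xi_op j - xi_op j * y_op i) (tn f w) =
  scalar_op u (\sum_(k | k != j)
    tn (swap_sign K k j i * msym (tperm j k) f) (bracket t j k *: w)).
Proof.
rewrite aendDE aendNE [X in X - _]aendME [X in _ - X]aendME y_opE !xi_opE.
rewrite -[X in X - _]aendME -scalar_y aendME -raddfB raddf_sum -sumrB.
congr (scalar_op u _); apply: eq_bigr => k kj.
rewrite /= y_opE divdiff_mulX // tnDl opprD addrA subrr.
by rewrite sub0r tpermC [bracket t j k]bracketN 1?eq_sym // scaleNr tnNr.
Qed.

Lemma y_xi i j : i != j ->
  y_op i * xi_op j - xi_op j * y_op i = scalar_op u * bracket t_op i j.
Proof.
move=> ij; apply: tn_ext => f w; rewrite y_xi_tens aendME bracket_op // map_opE.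
congr (scalar_op u _); rewrite (bigD1 i) //= big1 ?addr0 => [|k /andP[kj ki]].
  rewrite /swap_sign eqxx (negPf ij) sub0r mulN1r tnNl tpermC.
  by rewrite [bracket t i j]bracketN // scaleNr tnNr.
by rewrite /swap_sign (negPf ij) (eq_sym i) (negPf ki) subrr mul0r tn0l.
Qed.

Lemma y_xi_diag i :
  y_op i * xi_op i - xi_op i * y_op i =
  scalar_op u * \sum_(k | k != i) bracket t_op i k.
Proof.
apply: tn_ext => f w; rewrite y_xi_tens aendME aend_sumE.
congr (scalar_op u _); apply: eq_bigr => k ki.
rewrite bracket_op 1?eq_sym // map_opE /swap_sign eqxx eq_sym (negPf ki).
by rewrite subr0 mul1r.
Qed.

Lemma y_xi_anticommutator k i j : i != j ->
  GRing.comm (y_op k) (xi_op i * xi_op j + xi_op j * xi_op i).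
Proof.
apply: (@anticommutator_commutes _ _ (scalar_op u) y_op xi_op (bracket t_op)).
- exact: scalar_xi.
- exact: (bracket_intertwine t_xi).
- exact: y_xi.
- exact: y_xi_diag.
Qed.

(** The module [P (x) W] is generated over the polynomials by the pure tensors
    [1 (x) w]. *)
Lemma op_eq0 (Q : aend M) :
  (forall c, GRing.comm (scalar_op c) Q) -> (forall k, GRing.comm (y_op k) Q) ->
  (forall w, Q (tn 1 w) = 0) -> Q = 0.
Proof.
move=> scalarQ yQ Q1; apply: tn_ext => f w; rewrite aend0E.
elim/mpoly_gen_ind: f => [f g hf hg|c f hf||k f hf] //.
- by rewrite tnDl raddfD /= hf hg addr0.
- by rewrite -scalar_opE -[LHS]aendME -scalarQ aendME hf raddf0.
- by rewrite -y_opE -[LHS]aendME -yQ aendME hf raddf0.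
Qed.

(** Expanding the products would lead to the quadratic relations between three
    divided differences; these are avoided by looking only at commutators with
    the variables and at the values on [1 (x) w]. *)
Lemma xi_anti i j : i != j -> xi_op i * xi_op j = - (xi_op j * xi_op i).
Proof.
move=> ij; apply/eqP; rewrite -addr_eq0; apply/eqP/op_eq0 => [c|k|w].
- by apply: commrD; apply: commrM; apply: scalar_xi.
- exact: y_xi_anticommutator.
- by rewrite aendDE [X in X + _]aendME [X in _ + X]aendME !xi_op1 !raddf0 addr0.
Qed.

(** The morphism from the free algebra given by the operators therefore factors
    through the spin double affine Hecke algebra. *)
Lemma daha_rel_op (F : lalgType K) (phi : {rmorphism F -> aend M})
    (x y : 'I_n -> F) (s : 'I_n.-1 -> F) :
  (forall c, phi c%:A = scalar_op c) ->
  (forall i, phi (x i) = xi_op i) -> (forall i, phi (y i) = y_op i) ->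
  (forall a, phi (s a) = t_op a) ->
  forall l r, daha_rel u x y s l r -> phi l = phi r.
Proof.
move=> phic phix phiy phis l r.
have phiZ (c : K) (a : F) : phi (c *: a) = scalar_op c * phi a.
  by rewrite -[in LHS](mul1r a) scalerAl rmorphM phic.
have phib i j : phi (bracket s i j) = bracket t_op i j.
  rewrite bracket_rmorph; congr (bracket _ i j).
  by apply: funext => a; apply: phis.
case=> {l r}.
- by move=> l r; apply: spin_rel_morph phis t_op_rel _ _.
- move=> i j ij; rewrite rmorphN !rmorphM [LHS]/= [RHS]/= !phix.
  exact: xi_anti.
- move=> i j ij; rewrite !rmorphM [LHS]/= [RHS]/= !phiy.
  exact: mul_op_comm.
- move=> a i j ia ja; rewrite rmorphN !rmorphM [LHS]/= [RHS]/= !phix phis.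
  by rewrite t_xi (simple_tpermE ia ja) tpermL.
- move=> a i j ia ja; rewrite !rmorphM [LHS]/= [RHS]/= !phiy phis.
  by rewrite t_y (simple_tpermE ia ja) tpermL.
- move=> a i ia ja; rewrite rmorphN !rmorphM [LHS]/= [RHS]/= phix phis.
  by rewrite t_xi simple_tperm_fix.
- move=> a i ia ja; rewrite !rmorphM [LHS]/= [RHS]/= phiy phis.
  by rewrite t_y simple_tperm_fix.
- move=> i j ij; rewrite rmorphB !rmorphM phiZ [LHS]/= phix phiy phib.
  exact: y_xi.
- move=> i; rewrite rmorphB !rmorphM phiZ [LHS]/= phix phiy rmorph_sum.
  rewrite y_xi_diag; congr (_ * _); apply: eq_bigr => k ki.
  by rewrite /= phib.
Qed.

End SpinDunklOperators.

(** * Maps commuting with the action *)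

Section DahaRelationImage.
Variables (K : comNzRingType) (n : nat) (u : K) (F : lalgType K).
Variables (xi y : 'I_n -> F) (t : 'I_n.-1 -> F).
Variables (H : pzRingType) (phi : {rmorphism F -> H}).
Hypothesis phi_rel : forall l r, daha_rel u xi y t l r -> phi l = phi r.
Let Y i := phi (y i).
Let X i := phi (xi i).
Let T a := phi (t a).

Lemma daha_image_spin l r : spin_rel T l r -> l = r.
Proof.
apply: (spin_rel_image (phi := phi) (t := t)) => [//|{}l {}r h].
exact/phi_rel/daha_spin.
Qed.

Lemma daha_image_t_y a i : T a * Y i = Y (simple_tperm a i) * T a.
Proof.
pose i0 := Ordinal (ltn_ord_pred a); pose i1 := Ordinal (ltnS_ord_pred a).
have TK : T a * T a = 1 by apply/daha_image_spin/spin_sqr.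
have T0 : T a * Y i0 = Y i1 * T a.
  by rewrite -!rmorphM; apply/phi_rel/daha_t_y.
rewrite /simple_tperm -/i0 -/i1; case: tpermP => [->|->|i0i i1i] //.
  (* The relation at the upper index is the one at the lower index conjugated
     by the involution [T a]. *)
  have := congr1 (fun z => T a * (z * T a)) T0.
  by rewrite /= -!mulrA TK mulr1 (mulrA (T a) (T a)) TK mul1r.
rewrite -!rmorphM; apply/phi_rel/daha_t_y_far.
  by apply: contra_notN i0i => /eqP h; apply: val_inj.
by apply: contra_notN i1i => /eqP h; apply: val_inj.
Qed.

Lemma daha_image_y_xi i j : X j * Y i = Y i * X j -
  phi u%:A * (if i == j then \sum_(k | k != i) bracket T i k
              else bracket T i j).
Proof.
have phib k l : bracket T k l = phi (bracket t k l) by rewrite bracket_rmorph.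
suff -> : phi u%:A * (if i == j then \sum_(k | k != i) bracket T i k
              else bracket T i j) = Y i * X j - X j * Y i.
  by rewrite opprB addrC subrK.
rewrite -!rmorphM -rmorphB; case: eqVneq => [<-|ij].
  rewrite (phi_rel (daha_y_xi_diag u xi y t i)).
  rewrite (eq_bigr _ (fun k _ => phib i k)) -rmorph_sum -rmorphM.
  by rewrite -scalerAl mul1r.
by rewrite (phi_rel (daha_y_xi u xi y t ij)) phib -rmorphM -scalerAl mul1r.
Qed.

End DahaRelationImage.

Lemma bracket_closed (n : nat) (H : pzRingType) (t : 'I_n.-1 -> H)
    (Q : H -> Prop) :
  Q 1 -> (forall a b, Q a -> Q b -> Q (a * b)) -> (forall a, Q a -> Q (- a)) ->
  (forall a, Q (t a)) -> forall i j, Q (bracket t i j).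
Proof.
move=> Q1 QM QN Qt i j.
have Qlt p q : Q (bracket_lt t p q).
  apply: (QM).
    by elim: (q - p - 1)%N => [//|m IH]; rewrite exprS mulN1r; apply: QN.
  by apply: (QM); elim/big_rec: _ => // a x _; apply: QM.
by rewrite /bracket; case: ifP => _ //; apply: QN.
Qed.

(** Here [theta] stands for the identification of [P (x) W] with the induced
    module and [rho] for the action of [H] on [P (x) W]. *)
Section Intertwining.
Variables (K : comNzRingType) (n : nat) (W M : zmodType).
Local Notation P := {mpoly K[n]}.
Variables (tn : P -> W -> M).
Hypothesis tnDl : forall f g w, tn (f + g) w = tn f w + tn g w.
Variables (H : pzRingType) (V : lmodType H).
Variables (rho : {rmorphism H -> aend M}) (theta : {additive M -> V}).
Hypothesis tn_ext : forall F G : {additive M -> V},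
  (forall f w, F (tn f w) = G (tn f w)) -> F =1 G.

Definition intertwined (b : H) := forall x, theta (rho b x) = b *: theta x.

Lemma intertwined1 : intertwined 1.
Proof. by move=> x; rewrite rmorph1 scale1r. Qed.

Lemma intertwined0 : intertwined 0.
Proof. by move=> x; rewrite rmorph0 scale0r aend0E raddf0. Qed.

Lemma intertwinedM a b : intertwined a -> intertwined b -> intertwined (a * b).
Proof. by move=> ha hb x; rewrite rmorphM aendME ha hb scalerA. Qed.

Lemma intertwinedN a : intertwined a -> intertwined (- a).
Proof. by move=> ha x; rewrite rmorphN aendNE raddfN /= ha scaleNr. Qed.

Lemma intertwinedD a b : intertwined a -> intertwined b -> intertwined (a + b).
Proof. by move=> ha hb x; rewrite rmorphD aendDE raddfD /= ha hb scalerDl. Qed.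

Lemma intertwined_bracket (t : 'I_n.-1 -> H) i j :
  (forall a, intertwined (t a)) -> intertwined (bracket t i j).
Proof.
move=> tI; apply: bracket_closed => //.
- exact: intertwined1.
- exact: intertwinedM.
- exact: intertwinedN.
Qed.

Lemma intertwined_sum I (r : seq I) (Q : pred I) (F : I -> H) :
  (forall i, Q i -> intertwined (F i)) -> intertwined (\sum_(i <- r | Q i) F i).
Proof.
move=> FI; elim/big_ind: _ => //; first exact: intertwined0.
exact: intertwinedD.
Qed.

Lemma intertwined_tens (b : H) :
  (forall f w, theta (rho b (tn f w)) = b *: theta (tn f w)) -> intertwined b.
Proof.
have bM : zmod_morphism (fun x => b *: theta x).
  by move=> x y; rewrite raddfB scalerBr.
pose B : {additive M -> V} :=
  HB.pack (fun x => b *: theta x) (GRing.isZmodMorphism.Build M V _ bM).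
by move=> bE; apply: (tn_ext (F := theta \o rho b) (G := B)) => f w; apply: bE.
Qed.

Variables (s : K -> H) (Y : 'I_n -> H).
Hypothesis rho_s : forall c f w, rho (s c) (tn f w) = tn (c *: f) w.
Hypothesis rho_y : forall i f w, rho (Y i) (tn f w) = tn ('X_i * f) w.

Hypothesis theta_s : forall c, intertwined (s c).
Hypothesis theta_y : forall i, intertwined (Y i).

(** Every pure tensor is obtained from some [1 (x) w] by scalars and variables,
    which can be moved to the left of [b] at the cost of terms [d] that are
    already known to commute with [theta]. *)
Lemma intertwined_gen (b : H) :
  (forall w, theta (rho b (tn 1 w)) = b *: theta (tn 1 w)) ->
  (forall c, b * s c = s c * b) ->
  (forall i, exists j d, intertwined d /\ b * Y i = Y j * b + d) ->
  intertwined b.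
Proof.
move=> b1 bs bY; apply: intertwined_tens => f w.
elim/mpoly_gen_ind: f => [f g hf hg|c f hf||i f hf] //.
- by rewrite tnDl !raddfD /= hf hg.
- by rewrite -rho_s -aendME -rmorphM bs rmorphM aendME !theta_s hf !scalerA bs.
- have [j [d [dI bYE]]] := bY i.
  rewrite -rho_y -aendME -rmorphM bYE rmorphD aendDE rmorphM aendME raddfD /=.
  by rewrite !theta_y dI hf !scalerA -scalerDl bYE.
Qed.

End Intertwining.

(** * The representation and the induced module *)

Lemma commuting_monomial_mulX (n : nat) (B : pzRingType) (Y : 'I_n -> B)
    (i : 'I_n) (m : 'X_{1..n}) :
  (forall j k, GRing.comm (Y j) (Y k)) ->
  \prod_(k < n) Y k ^+ (U_(i) + m)%MM k = Y i * \prod_(k < n) Y k ^+ m k.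
Proof.
move=> Yc; under eq_bigr do rewrite mnmDE exprD.
rewrite prodrM_comm => [|j k _ _]; last by apply/commrX/commr_sym/commrX.
congr (_ * _); rewrite (eq_bigr (fun k => if k == i then Y i else 1)).
  rewrite -big_mkcond big_pred1_eq //.
by move=> k _; rewrite mnm1E eq_sym; case: eqVneq => [->|].
Qed.

Lemma commuting_image (A B : pzRingType) (phi : {rmorphism A -> B}) (x y : A) :
  phi (x * y) = phi (y * x) -> GRing.comm (phi x) (phi y).
Proof. by rewrite !rmorphM. Qed.

Section SpinDahaRepresentation.
Variables (K : idomainType) (n : nat) (u : K).
Variables (W : lmodType (spin_alg K n)) (E : xi0_extension u W).
Local Notation P := {mpoly K[n]}.
Local Notation PW := (poly_tensor W).
Local Notation H := (spin_daha n u).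
Implicit Types (i j k : 'I_n) (a : 'I_n.-1) (f g : P) (w : W).
Local Notation gens := ('I_n + 'I_n + 'I_n.-1)%type.
Local Notation free_xi := (fun i : 'I_n => free_gen K (inl (inl i) : gens)).
Local Notation free_y := (fun i : 'I_n => free_gen K (inl (inr i) : gens)).
Local Notation free_t := (fun a : 'I_n.-1 => free_gen K (inr a : gens)).
Local Notation scalar := (palg_scalar (daha_rel u free_xi free_y free_t)).

Definition mul_end : {rmorphism P -> aend PW} := scale_end PW.
Local Notation xiO := (xi_op u (@spin_t K n) mul_end (tensor_map W)).
Local Notation yO := (y_op mul_end).
Local Notation tO := (t_op (@spin_t K n) (tensor_map W)).
Local Notation sO := (scalar_op mul_end).

Lemma scalar_op_scale c (x : PW) : sO c x = c%:MP *: x.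
Proof. by []. Qed.

Lemma mul_endE f g w : mul_end f (poly_tens g w) = poly_tens (f * g) w.
Proof. exact: poly_tens_mul. Qed.

Definition gen_op (x : gens) : aend PW :=
  match x with
  | inl (inl i) => xiO i
  | inl (inr i) => yO i
  | inr a => tO a
  end.

Lemma scalar_gen_op c x : GRing.comm (sO c) (gen_op x).
Proof.
have tE := @tensor_mapE K n W.
case: x => [[i|i]|a].
- exact: (scalar_xi u _ (@poly_tens_ext K n W) mul_endE tE).
- exact: scalar_y.
- exact: (scalar_t _ (@poly_tens_ext K n W) mul_endE tE).
Qed.

Definition free_op := free_lift_rmorphism scalar_gen_op.

Lemma free_op_rel l r : daha_rel u free_xi free_y free_t l r ->
  free_op l = free_op r.
Proof.
apply: (daha_rel_op (@spin_t_rel K n) (@poly_tensDl K n W) (@poly_tensDr K n W)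
  (@poly_tens_ext K n W) mul_endE (@tensor_mapE K n W)) => [c|i|i|a].
- exact: free_lift_scalar.
- exact: free_lift_gen.
- exact: free_lift_gen.
- exact: free_lift_gen.
Qed.

Definition daha_repr : {rmorphism H -> aend PW} :=
  palg_lift_rmorphism scalar_gen_op free_op_rel.

Lemma daha_repr_xi i : daha_repr (gen_xi u i) = xiO i.
Proof. exact: (palg_lift_gen scalar_gen_op free_op_rel). Qed.
Lemma daha_repr_y i : daha_repr (gen_y u i) = yO i.
Proof. exact: (palg_lift_gen scalar_gen_op free_op_rel). Qed.
Lemma daha_repr_t a : daha_repr (gen_t u a) = tO a.
Proof. exact: (palg_lift_gen scalar_gen_op free_op_rel). Qed.
Lemma daha_repr_scalar c : daha_repr (scalar c) = sO c.
Proof. exact: (palg_lift_scalar scalar_gen_op free_op_rel). Qed.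

Lemma ind_tens_scale (a b : H) w : a *: ind_tens E b w = ind_tens E (a * b) w.
Proof. exact: tensor_scale_tens. Qed.

Lemma ind_tens_sub (b : daha_sub n u) (a : H) w :
  ind_tens E (a * subalg_val b) w = ind_tens E a (xact E b w).
Proof.
exact: (tensM (phi := @subalg_incl _ _ _ (@daha_xi_gens K n u))
  (W := xi0_module E)).
Qed.

Lemma ident_is_zmod_morphism : zmod_morphism (ident E).
Proof.
pose V := Defs.restrict (@palg_scalar K _ _ : {rmorphism K -> spin_alg K n}) W.
apply: (tensor_lift_is_zmod_morphism (W := V)) => [a b v|a v1 v2|a c v].
- by rewrite poly_eltD; apply: tensDl.
- exact: tensDr.
- rewrite poly_eltMC -palg_scalar_central.
  rewrite -[palg_scalar _ c]/(subalg_val (sub_scalar n u c)) ind_tens_sub.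
  by congr (ind_tens _ _ _); apply: xact_scalar.
Qed.

Definition ident_additive : {additive PW -> induced E} := HB.pack (ident E)
  (GRing.isZmodMorphism.Build PW (induced E) (ident E) ident_is_zmod_morphism).

Definition daha_pi : {rmorphism free_alg K gens -> H} :=
  palg_pi (daha_rel u free_xi free_y free_t).

Lemma daha_pi_rel l r : daha_rel u free_xi free_y free_t l r ->
  daha_pi l = daha_pi r.
Proof. by move=> h; apply/rquot_eqP/ideal_gen_rel. Qed.

Lemma gen_y_comm i j : GRing.comm (gen_y u i) (gen_y u j).
Proof.
have [->//|ij] := eqVneq i j.
exact: (@commuting_image _ _ daha_pi (free_y i) (free_y j)
  (daha_pi_rel (daha_y u free_xi free_y free_t ij))).
Qed.

Lemma poly_elt1 : poly_elt u (1 : P) = 1.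
Proof.
rewrite /poly_elt msupp1 big_seq1 mcoeff1 eqxx scale1r big1 // => i _.
by rewrite mnm0E expr0.
Qed.

Lemma poly_eltX (m : 'X_{1..n}) :
  poly_elt u 'X_[m] = \prod_(k < n) gen_y u k ^+ m k.
Proof. by rewrite /poly_elt msuppX big_seq1 mcoeffX eqxx scale1r. Qed.

Lemma poly_eltZ (c : K) f : poly_elt u (c *: f) = c *: poly_elt u f.
Proof. by rewrite -poly_eltMC mulrC mul_mpolyC. Qed.

Lemma scale_mulr (c : K) (a b : H) : c *: (a * b) = a * (c *: b).
Proof. by rewrite -!palg_scalar_central mulrA. Qed.

Lemma poly_elt_mulX i f : poly_elt u ('X_i * f) = gen_y u i * poly_elt u f.
Proof.
elim/mpolyind: f => [|c m f _ _ IH].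
  rewrite mulr0 /poly_elt msupp0 big_nil.
  exact: (esym (mulr0 (gen_y u i))).
rewrite mulrDr -scalerAr -mpolyXD !poly_eltD !poly_eltZ !poly_eltX IH.
rewrite commuting_monomial_mulX; last exact: gen_y_comm.
exact: (etrans (congr1 (+%R^~ _) (scale_mulr c _ _)) (esym (mulrDr _ _ _))).
Qed.

Lemma daha_repr_scalar_tens c f w :
  daha_repr (scalar c) (poly_tens f w) = poly_tens (c *: f) w.
Proof. by rewrite daha_repr_scalar; apply: (scalar_opE mul_endE). Qed.

Lemma daha_repr_y_tens i f w :
  daha_repr (gen_y u i) (poly_tens f w) = poly_tens ('X_i * f) w.
Proof. by rewrite daha_repr_y; apply: mul_endE. Qed.

Lemma poly_tensor_additive_ext (F G : {additive PW -> induced E}) :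
  (forall f w, F (poly_tens f w) = G (poly_tens f w)) -> F =1 G.
Proof. by move=> FG; apply: eq_tensor_additive => f w; apply: FG. Qed.

Lemma ident_scale_tens (b : H) f w :
  b *: ident E (poly_tens f w) = ind_tens E (b * poly_elt u f) w.
Proof.
exact: etrans (congr1 ( *:%R b) (ident_tens E f w)) (ind_tens_scale _ _ _).
Qed.

Definition intertwined_ident : H -> Prop :=
  intertwined daha_repr ident_additive.

Lemma ident_scalar c : intertwined_ident (scalar c).
Proof.
apply: (intertwined_tens poly_tensor_additive_ext) => f w.
rewrite daha_repr_scalar_tens ident_scale_tens.
apply: (etrans (ident_tens E _ w)).
exact: (congr1 (ind_tens E ^~ w) (poly_eltZ c f)).
Qed.

Lemma ident_y i : intertwined_ident (gen_y u i).
Proof.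
apply: (intertwined_tens poly_tensor_additive_ext) => f w.
rewrite daha_repr_y_tens ident_scale_tens; apply: (etrans (ident_tens E _ w)).
exact: (congr1 (ind_tens E ^~ w) (poly_elt_mulX i f)).
Qed.

Lemma poly_tens0r f : poly_tens f (0 : W) = 0.
Proof. exact: (tn0r (@poly_tensDr K n W)). Qed.

(** The subalgebra generated by the [t_a] and [xi_i] acts on the [1 (x) w] as it
    does on [W], because [xi_op] kills them. *)
Lemma daha_repr_sub (b : daha_sub n u) w :
  daha_repr (subalg_val b) (poly_tens 1 w) = poly_tens 1 (xact E b w).
Proof.
have subE (b1 b2 : daha_sub n u) : subalg_val b1 = subalg_val b2 -> b1 = b2.
  exact: val_inj.
have : subalg_gen (@daha_xi_gens K n u) (subalg_val b).
  by case: b => x /= /asboolP.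
move vE: (subalg_val b) => v hv.
elim: hv b vE w => {v}
  [v [a|i]|c|v1 v2 h1 IH1 h2 IH2|v1 v2 h1 IH1 h2 IH2] b vE w.
- rewrite (subE b (sub_t u a) vE) xact_t daha_repr_t.
  by rewrite (t_op1 _ (@tensor_mapE K n W)).
- rewrite (subE b (sub_xi u i) vE) xact_xi daha_repr_xi poly_tens0r.
  exact: (xi_op1 u _ (@poly_tensDl K n W) mul_end (@tensor_mapE K n W)).
- rewrite (subE b (sub_scalar n u c) vE) xact_scalar daha_repr_scalar_tens.
  exact: poly_tens_scale.
- rewrite (subE b (subalg_elt h1 - subalg_elt h2) vE) rmorphB aendDE aendNE.
  rewrite (IH1 (subalg_elt h1) erefl) (IH2 (subalg_elt h2) erefl).
  rewrite -(tnNr (@poly_tensDr K n W)) -poly_tensDr; congr poly_tens.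
  exact: (esym (scalerBl (subalg_elt h1) (subalg_elt h2) (w : xi0_module E))).
- rewrite (subE b (subalg_elt h1 * subalg_elt h2) vE) rmorphM aendME.
  rewrite (IH2 (subalg_elt h2) erefl) (IH1 (subalg_elt h1) erefl).
  by rewrite xactA.
Qed.

Lemma ident_sub1 (b : daha_sub n u) w :
  ident E (daha_repr (subalg_val b) (poly_tens 1 w)) =
  subalg_val b *: ident E (poly_tens 1 w).
Proof.
rewrite daha_repr_sub ident_scale_tens; apply: (etrans (ident_tens E _ _)).
rewrite poly_elt1 mulr1 -[subalg_val b]mul1r; apply: esym.
exact: ind_tens_sub.
Qed.

(** This map is well defined on the induced module by [daha_repr_sub]. It
    provides the injectivity of the identification, which makes the action
    [circ] unambiguous. *)
Definition ident_retraction : induced E -> PW :=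
  tensor_lift (fun (a : H) (w : xi0_module E) =>
    daha_repr a (poly_tens 1 (w : W))).

Lemma ident_retraction_balanced :
  [/\ forall (a b : H) w, daha_repr (a + b) (poly_tens 1 w) =
        daha_repr a (poly_tens 1 w) + daha_repr b (poly_tens 1 w),
      forall (a : H) v w, daha_repr a (poly_tens 1 (v + w)) =
        daha_repr a (poly_tens 1 v) + daha_repr a (poly_tens 1 w) &
      forall (a : H) (b : daha_sub n u) w,
        daha_repr (a * subalg_val b) (poly_tens 1 w) =
        daha_repr a (poly_tens 1 (xact E b w))].
Proof.
split=> [a b w|a v w|a b w].
- by rewrite rmorphD aendDE.
- by rewrite poly_tensDr raddfD.
- by rewrite rmorphM aendME daha_repr_sub.
Qed.

Lemma ident_retraction_is_zmod_morphism : zmod_morphism ident_retraction.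
Proof.
have [hl hr hM] := ident_retraction_balanced.
exact: tensor_lift_is_zmod_morphism.
Qed.

Definition ident_retraction_additive : {additive induced E -> PW} :=
  HB.pack ident_retraction
    (GRing.isZmodMorphism.Build (induced E) PW ident_retraction
       ident_retraction_is_zmod_morphism).

Lemma ident_retraction_tens (a : H) w :
  ident_retraction (ind_tens E a w) = daha_repr a (poly_tens 1 w).
Proof.
by have [hl hr hM] := ident_retraction_balanced; apply: tensor_lift_tens.
Qed.

Lemma daha_repr_poly_elt f w :
  daha_repr (poly_elt u f) (poly_tens 1 w) = poly_tens f w.
Proof.
elim/mpoly_gen_ind: f => [f g hf hg|c f hf||i f hf].
- rewrite poly_eltD rmorphD aendDE.
  exact: etrans (congr2 +%R hf hg) (esym (poly_tensDl f g w)).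
- rewrite poly_eltZ palg_scalarE rmorphM aendME hf.
  exact: daha_repr_scalar_tens.
- by rewrite poly_elt1 rmorph1.
- rewrite poly_elt_mulX rmorphM aendME.
  exact: etrans (congr1 (daha_repr (gen_y u i)) hf) (daha_repr_y_tens i f w).
Qed.

Lemma identK : cancel (ident E) ident_retraction.
Proof.
move=> x.
apply: (@eq_tensor_additive _ _ _ _ _
  (ident_retraction_additive \o ident_additive) idfun) => f w.
rewrite /=; apply: (etrans (congr1 ident_retraction (ident_tens E f w))).
by rewrite ident_retraction_tens daha_repr_poly_elt.
Qed.

Let intertwined_ident_gen (b : daha_sub n u) :
  (forall i, exists j d, intertwined_ident d /\
     subalg_val b * gen_y u i = gen_y u j * subalg_val b + d) ->
  intertwined_ident (subalg_val b).
Proof.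
apply: (intertwined_gen (@poly_tensDl K n W) poly_tensor_additive_ext
  daha_repr_scalar_tens daha_repr_y_tens ident_scalar ident_y).
- exact: ident_sub1.
- by move=> c; apply: palg_scalar_central.
Qed.

Lemma ident_t a : intertwined_ident (gen_t u a).
Proof.
apply: (@intertwined_ident_gen (sub_t u a)) => i.
exists (simple_tperm a i), 0; split; first exact: intertwined0.
by rewrite addr0; apply: (daha_image_t_y daha_pi_rel).
Qed.

Lemma ident_xi i : intertwined_ident (gen_xi u i).
Proof.
apply: (@intertwined_ident_gen (sub_xi u i)) => j.
pose d := scalar u * (if j == i then \sum_(k | k != j) bracket (gen_t u) j k
                      else bracket (gen_t u) j i).
exists j, (- d); split; last exact: (daha_image_y_xi daha_pi_rel).
have bI p q : intertwined_ident (bracket (gen_t u) p q).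
  exact: intertwined_bracket ident_t.
apply: intertwinedN; apply: intertwinedM; first exact: ident_scalar.
case: (j == i); last exact: bI.
by apply: intertwined_sum => k _; apply: bI.
Qed.

(** By injectivity of the identification, the required element is the only one
    with the prescribed image. *)
Lemma circ_intertwined (b : H) x :
  intertwined_ident b -> circ E b x = daha_repr b x.
Proof.
move=> bI; apply: xget_unique => [|z zE]; first exact: bI.
exact: (can_inj identK (etrans zE (esym (bI x)))).
Qed.

Lemma xi_circ i f w : circ E (gen_xi u i) (poly_tens f w) =
  u%:MP *: \sum_(k < n | k != i)
    poly_tens (mquot (f - msym (tperm k i) f) ('X_i - 'X_k))
              (bracket (@spin_t K n) k i *: w).
Proof.
apply: (etrans (circ_intertwined _ (@ident_xi i))); rewrite daha_repr_xi.
apply: (etrans (xi_opE u _ mul_end (@tensor_mapE K n W) i f w)).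
apply: (etrans (scalar_op_scale u _)); apply: (congr1 ( *:%R u%:MP)).
by apply: eq_bigr => k ki; rewrite divdiffE.
Qed.

End SpinDahaRepresentation.

Unset Implicit Arguments.
Set Strict Implicit.
Local Open Scope complex_scope.

Theorem theorem3p9 (R : realType) (n : nat) (hn : (1 <= n)%N)
    (u : R[i]) (hu : u != 0)
    (W : lmodType (spin_alg R[i] n)) (E : xi0_extension u W)
    (f : {mpoly R[i][n]}) (w : W) (i : 'I_n) :
  circ E (gen_xi u i) (poly_tens f w) =
  u%:MP *: \sum_(k < n | k != i)
    poly_tens (mquot (f - msym (tperm k i) f) ('X_i - 'X_k))
              (bracket (@spin_t R[i] n) k i *: w).
Proof. exact: xi_circ. Qed.
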